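(* Let $n\ge3$ and $h_2=(2,n,\ldots,n)$, i.e. $h_2(1)=2$ and $h_2(j)=n$ for $2\le j\le n$. Then there is an isomorphism of $\mathbb{C}$-algebras $$\mathbb{C}[\mathrm{Hess}(N,h_2)\cap\Omega_e^\circ]\;\cong\;\frac{\mathbb{C}[X,Y,Z]}{(XY-Z^n)}\otimes\mathbb{C}[x_{32},x_{42},\ldots,x_{n-1\,2}]\otimes\mathbb{C}[x_{ij}\mid 3\le j<i\le n]$$ under which (reading the correspondence from right to left) $$X\mapsto x_{21}^2-x_{31},\qquad Y\mapsto x_{21}^{n-2}+x_{32}x_{21}^{n-3}+\cdots+x_{n-1\,2}x_{21}+x_{n2},\qquad Z\mapsto x_{21},$$ $$x_{i2}\mapsto x_{i2}\ \ (3\le i\le n-1),\qquad x_{ij}\mapsto x_{ij}\ \ (3\le j<i\le n).$$ In other words, $$\mathrm{Hess}(N,h_2)\cap\Omega_e^\circ\cong\mathbb{C}^2/\mathfrak{C}_n\times\mathbb{C}^{\frac12(n-1)(n-2)-1}.$$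
   Context: Write $[n]=\{1,\ldots,n\}$. $Fl(\mathbb{C}^n)$ is the variety of full flags $V_\bullet=(V_1\subset\cdots\subset V_n=\mathbb{C}^n)$, $\dim V_i=i$, identified with $\mathrm{GL}_n(\mathbb{C})/B$ ($B$ = upper triangular invertible matrices) by letting the first $j$ columns of $g$ span $V_j$. Let $N$ be the $n\times n$ nilpotent matrix consisting of a single Jordan block ($N_{i,i+1}=1$, all other entries $0$). For a nondecreasing $h:[n]\to[n]$ with $h(j)\ge j$ for all $j$ (a Hessenberg function), $\mathrm{Hess}(N,h)=\{V_\bullet\in Fl(\mathbb{C}^n)\mid NV_i\subset V_{h(i)}\text{ for all }i\in[n]\}$, a (reduced) closed subvariety. $\Omega_e^\circ$ is the opposite Schubert cell of the identity, i.e. the orbit of $eB$ under the lower triangular invertible matrices, an open affine subset identified with the set of lower triangular unipotent matrices $g=(x_{ij})$; so $\mathbb{C}[\Omega_e^\circ]=\mathbb{C}[x_{ij}\mid 1\le j<i\le n]$ and $\mathbb{C}[\mathrm{Hess}(N,h_2)\cap\Omega_e^\circ]$ is a quotient of it; $x_{ij}$ on the Hessenberg side denotes the class of the coordinate function. All tensor products are over $\mathbb{C}$. $\mathfrak{C}_n$ is the cyclic group of order $n$ generated by a primitive $n$-th root of unity $\zeta$, acting on $\mathbb{C}^2$ by $\zeta\cdot(x,y)=(\zeta x,\zeta^{-1}y)$, and $\mathbb{C}^2/\mathfrak{C}_n$ is the quotient variety, with coordinate ring $\mathbb{C}[x,y]^{\mathfrak{C}_n}\cong\mathbb{C}[X,Y,Z]/(XY-Z^n)$.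 *)

(* Defs.v *)
From HB Require Import structures.
From mathcomp Require Import all_boot all_order all_algebra.
From mathcomp Require Import boolp classical_sets reals.
From mathcomp Require Import complex.
From mathcomp Require Import mpoly.
Set Implicit Arguments.
Unset Strict Implicit.
Unset Printing Implicit Defensive.
Import GRing.Theory.
Local Open Scope ring_scope.
Local Open Scope quotient_scope.

Lemma exists_unit_functional (F : fieldType) (A : algType F) :
  exists f : A -> F, scalar f /\ f 1 = 1.
Proof.
pose sub (W : set A) := forall c x y, W x -> W y -> W (c *: x + y).
pose P (W : set A) := sub W /\ ~ W 1.
have [W [[subW W1] maxW]] : exists W, P W /\ forall U, (W `<` U)%classic -> ~ P U.
  apply: Zorn_bigcup => H HP totH; split.
    move=> c x y [U HU Ux] [U' HU' U'y]; case: (totH _ _ HU HU') => UU'.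
      by exists U' => //; apply: (HP _ HU').1 => //; exact: UU'.
    by exists U => //; apply: (HP _ HU).1 => //; exact: UU'.
  by move=> [U HU]; exact: (HP _ HU).2.
have W0 : W 0.
  apply: contrapT => nW0.
  have Wempty x : ~ W x.
    by move=> Wx; apply: nW0; have := subW (-1) _ _ Wx Wx; rewrite scaleN1r addNr.
  apply: (maxW [set 0]%classic); last first.
    split; first by move=> c x y /= -> ->; rewrite scaler0 addr0.
    by move=> /= /eqP; rewrite oner_eq0.
  by split=> [x /Wempty//|/(_ 0 erefl)].
have WZ c x : W x -> W (c *: x).
  by move=> Wx; rewrite -[_ *: _]addr0; exact: subW.
have ex_c a : exists c : F, W (a - c *: 1).
  apply: contrapT => nc.
  apply: (maxW [set x | exists w d, W w /\ x = w + d *: a]%classic); split.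
  - by move=> x Wx; exists x, 0; rewrite scale0r addr0.
  - move=> sUW; apply: nc; exists 0; rewrite scale0r subr0.
    by apply: sUW; exists 0, 1; rewrite scale1r add0r.
  - move=> c _ _ [w [d [Ww ->]]] [w' [d' [Ww' ->]]].
    exists (c *: w + w'), (c * d + d'); split; first exact: subW.
    by rewrite scalerDr scalerA scalerDl addrACA.
  - move=> [w [d [Ww e1]]]; have [d0|d0] := eqVneq d 0.
      by apply: W1; rewrite e1 d0 scale0r addr0.
    apply: nc; exists d^-1; rewrite e1 scalerDr scalerA mulVf// scale1r.
    by rewrite opprD addrCA subrr addr0 -scaleN1r; exact/WZ/WZ.
pose f a := projT1 (cid (ex_c a)).
have fP a : W (a - f a *: 1) by rewrite /f; case: cid.
have fE a c : W (a - c *: 1) -> f a = c.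
  move=> Wc; apply/eqP; rewrite -subr_eq0; apply/negPn/negP => nz; apply: W1.
  have := WZ (f a - c)^-1 _ (subW (-1) _ _ (fP a) Wc).
  rewrite scaleN1r opprB addrA subrK -scalerBl scalerA mulVf//.
  by rewrite scale1r.
exists f; split; last by apply: fE; rewrite scale1r subrr.
move=> c x y; apply: fE.
rewrite scalerDl -scalerA opprD addrACA -scalerBr.
exact: subW.
Qed.

(** The tensor product [A ⊗ B] of commutative algebras over a field is the
   monoid of formal sums [sum_k a_k ⊗ b_k] (finite sequences of pairs, added
   by concatenation) modulo the least congruence making ⊗ bilinear; it is
   nontrivial because the base ring is a field. *)
Section Tensor.
Variables (F : fieldType) (A B : comAlgType F).
Implicit Types (s t u : seq (A * B)).

Inductive tens_rel : seq (A * B) -> seq (A * B) -> Prop :=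
| TensRefl s : tens_rel s s
| TensSym s t : tens_rel s t -> tens_rel t s
| TensTrans t s u : tens_rel s t -> tens_rel t u -> tens_rel s u
| TensCat s s' t t' :
    tens_rel s s' -> tens_rel t t' -> tens_rel (s ++ t) (s' ++ t')
| TensCatC s t : tens_rel (s ++ t) (t ++ s)
| TensZero b : tens_rel [:: (0, b)] [::]
| TensAddl a a' b : tens_rel [:: (a + a', b)] [:: (a, b); (a', b)]
| TensAddr a b b' : tens_rel [:: (a, b + b')] [:: (a, b); (a, b')]
| TensScale c a b : tens_rel [:: (c *: a, b)] [:: (a, c *: b)].

Definition tens_eq s t : bool := `[< tens_rel s t >].

Lemma tens_eq_is_equiv : equiv_class_of tens_eq.
Proof.
split.
- by move=> s; apply/asboolP; exact: TensRefl.
- by move=> s t; apply/asboolP/asboolP => /TensSym.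
- by move=> t s u /asboolP st /asboolP tu; apply/asboolP; exact: TensTrans tu.
Qed.
Canonical tens_eq_equiv := EquivRelPack tens_eq_is_equiv.
Canonical tens_eq_encModRel := defaultEncModRel tens_eq.

Definition tensor := {eq_quot tens_eq}.
HB.instance Definition _ := Choice.on tensor.
HB.instance Definition _ : EqQuotient _ tens_eq tensor := EqQuotient.on tensor.

Lemma tensP s t : tens_rel s t <-> \pi_tensor s = \pi_tensor t.
Proof. by split=> [st|/eqmodP/asboolP//]; apply/eqmodP/asboolP. Qed.

Lemma tens_ext s t : tens_rel s t -> \pi_tensor s = \pi_tensor t.
Proof. by move/tensP. Qed.

Lemma tens_reprK s : tens_rel (repr (\pi_tensor s)) s.
Proof. by apply/tensP; rewrite reprK. Qed.

Lemma tens_catr s s' t : tens_rel s s' -> tens_rel (s ++ t) (s' ++ t).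
Proof. by move=> ss'; apply: TensCat => //; exact: TensRefl. Qed.

Lemma tens_map (f : A -> A) (g : B -> B) :
    f 0 = 0 -> {morph f : x y / x + y} -> {morph g : x y / x + y} ->
    scalable f -> scalable g ->
  forall s t, tens_rel s t ->
  tens_rel [seq (f p.1, g p.2) | p <- s] [seq (f p.1, g p.2) | p <- t].
Proof.
move=> f0 fD gD fZ gZ s t; elim=> {s t} /=.
- by move=> s; exact: TensRefl.
- by move=> s t _; exact: TensSym.
- by move=> t s u _ st _; exact: TensTrans.
- by move=> s s' t t' _ ss' _ tt'; rewrite !map_cat; exact: TensCat.
- by move=> s t; rewrite !map_cat; exact: TensCatC.
- by move=> b; rewrite f0; exact: TensZero.
- by move=> a a' b; rewrite fD; exact: TensAddl.
- by move=> a b b'; rewrite gD; exact: TensAddr.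
- by move=> c a b; rewrite fZ gZ; exact: TensScale.
Qed.

Definition fs_scale (c : F) s := [seq (c *: p.1, p.2) | p <- s].
Definition fs_mul s t := [seq (p.1 * q.1, p.2 * q.2) | p <- s, q <- t].

Lemma fs_scale_rel c s t : tens_rel s t -> tens_rel (fs_scale c s) (fs_scale c t).
Proof.
apply: (@tens_map ( *:%R c) id) => //; first exact: scaler0.
- exact: scalerDr.
- by move=> a x; rewrite !scalerA mulrC.
Qed.

Lemma fs_mul_cons p s t :
  fs_mul (p :: s) t = [seq (p.1 * q.1, p.2 * q.2) | q <- t] ++ fs_mul s t.
Proof. by []. Qed.

Lemma fs_mul_catl s s' t : fs_mul (s ++ s') t = fs_mul s t ++ fs_mul s' t.
Proof. exact: allpairs_cat. Qed.

Lemma fs_mulr_rel s t t' : tens_rel t t' -> tens_rel (fs_mul s t) (fs_mul s t').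
Proof.
move=> tt'; elim: s => [|p s IHs]; first exact: TensRefl.
rewrite !fs_mul_cons; apply: TensCat => //.
apply: (@tens_map ( *%R p.1) ( *%R p.2)) => //; first exact: mulr0.
- exact: mulrDr.
- exact: mulrDr.
- by move=> a x /=; rewrite scalerAr.
- by move=> a x /=; rewrite scalerAr.
Qed.

Lemma tens_perm s t : perm_eq s t -> tens_rel s t.
Proof.
move=> /catCA_perm_ind ind; apply: ind (TensRefl s) => s1 s2 s3 ih.
apply: TensTrans ih _; rewrite !catA; apply: tens_catr; exact: TensCatC.
Qed.

Lemma fs_mulC s t : tens_rel (fs_mul s t) (fs_mul t s).
Proof.
elim: t => [|p t IHt]; first by rewrite /fs_mul allpairs0r; exact: TensRefl.
have st : perm_eq (fs_mul s (p :: t))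
    ([seq (q.1 * p.1, q.2 * p.2) | q <- s] ++ fs_mul s t).
  by rewrite /fs_mul (perm_allpairs_consr _ _ (fun=> p) (fun=> t)).
apply: TensTrans (tens_perm st) _.
rewrite fs_mul_cons; apply: TensCat => //.
rewrite (eq_map (g := fun q => (p.1 * q.1, p.2 * q.2))); first exact: TensRefl.
by move=> q /=; rewrite mulrC [q.2 * _]mulrC.
Qed.

Lemma fs_mull_rel s s' t : tens_rel s s' -> tens_rel (fs_mul s t) (fs_mul s' t).
Proof.
move=> ss'; apply: TensTrans (fs_mulC _ _) (TensTrans _ (fs_mulC _ _)).
exact: fs_mulr_rel.
Qed.

Lemma fs_mulA s t u : fs_mul s (fs_mul t u) = fs_mul (fs_mul s t) u.
Proof.
elim: s => [|p s IHs] //; rewrite !fs_mul_cons fs_mul_catl IHs; congr (_ ++ _).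
elim: t {IHs} => [|q t IHt] //=.
rewrite !fs_mul_cons map_cat IHt -map_comp; congr (_ ++ _).
by apply: eq_map => r /=; rewrite !mulrA.
Qed.

Lemma fs_mul_scale c s t : fs_mul (fs_scale c s) t = fs_scale c (fs_mul s t).
Proof.
elim: s => [|p s IHs] //=; rewrite !fs_mul_cons /fs_scale map_cat -map_comp.
rewrite -/(fs_scale _ _) IHs; congr (_ ++ _).
by apply: eq_map => q /=; rewrite scalerAl.
Qed.

Definition tens (a : A) (b : B) : tensor := \pi_tensor [:: (a, b)].
Definition t_zero : tensor := \pi_tensor [::].
Definition t_one : tensor := tens 1 1.
Definition t_add := lift_op2 tensor cat.
Definition t_scale (c : F) := lift_op1 tensor (fs_scale c).
Definition t_opp : tensor -> tensor := t_scale (-1).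
Definition t_mul := lift_op2 tensor fs_mul.

Lemma t_addE s t : t_add (\pi_tensor s) (\pi_tensor t) = \pi_tensor (s ++ t).
Proof.
by unlock t_add; apply: tens_ext; apply: TensCat; exact: tens_reprK.
Qed.

Lemma t_scaleE c s : t_scale c (\pi_tensor s) = \pi_tensor (fs_scale c s).
Proof.
by unlock t_scale; apply: tens_ext; apply: fs_scale_rel; exact: tens_reprK.
Qed.

Lemma t_mulE s t : t_mul (\pi_tensor s) (\pi_tensor t) = \pi_tensor (fs_mul s t).
Proof.
unlock t_mul; apply: tens_ext; apply: (@TensTrans (fs_mul s (repr (\pi_tensor t)))).
  by apply: fs_mull_rel; exact: tens_reprK.
by apply: fs_mulr_rel; exact: tens_reprK.
Qed.

Lemma t_addA : associative t_add.
Proof.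
move=> x y z; rewrite -[x]reprK -[y]reprK -[z]reprK.
by rewrite !t_addE catA.
Qed.

Lemma t_addC : commutative t_add.
Proof.
move=> x y; rewrite -[x]reprK -[y]reprK !t_addE.
by apply: tens_ext; exact: TensCatC.
Qed.

Lemma t_add0 : left_id t_zero t_add.
Proof. by move=> x; rewrite -[x]reprK t_addE. Qed.

Lemma t_ind (P : tensor -> Prop) :
    P t_zero -> (forall a b x, P x -> P (t_add (tens a b) x)) ->
  forall x, P x.
Proof.
move=> P0 PD x; rewrite -[x]reprK; elim: (repr x) => [|[a b] s IHs] //.
by rewrite -cat1s -t_addE; exact: PD.
Qed.

Lemma t_tensDl a a' b : tens (a + a') b = t_add (tens a b) (tens a' b).
Proof. by rewrite t_addE; apply: tens_ext; exact: TensAddl. Qed.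

Lemma t_tensDr a b b' : tens a (b + b') = t_add (tens a b) (tens a b').
Proof. by rewrite t_addE; apply: tens_ext; exact: TensAddr. Qed.

Lemma t_tens0l b : tens 0 b = t_zero.
Proof. by apply: tens_ext; exact: TensZero. Qed.

Lemma t_tensZl c a b : tens (c *: a) b = t_scale c (tens a b).
Proof. by rewrite t_scaleE. Qed.

Lemma t_tensZr c a b : tens a (c *: b) = t_scale c (tens a b).
Proof. by rewrite -t_tensZl; apply: tens_ext; exact/TensSym/TensScale. Qed.

Lemma t_scaleDr c x y : t_scale c (t_add x y) = t_add (t_scale c x) (t_scale c y).
Proof.
rewrite -[x]reprK -[y]reprK !t_addE !t_scaleE t_addE.
by rewrite /fs_scale map_cat.
Qed.

Lemma t_scale0 c : t_scale c t_zero = t_zero.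
Proof. by rewrite t_scaleE. Qed.

Lemma t_scaleDl x c d : t_scale (c + d) x = t_add (t_scale c x) (t_scale d x).
Proof.
elim/t_ind: x => [|a b x IHx]; first by rewrite !t_scale0 t_add0.
rewrite !t_scaleDr IHx -!t_tensZl scalerDl t_tensDl -!t_addA.
by congr t_add; rewrite t_addA [X in t_add X _]t_addC -t_addA.
Qed.

Lemma t_scaleA c d x : t_scale c (t_scale d x) = t_scale (c * d) x.
Proof.
rewrite -[x]reprK !t_scaleE /fs_scale -map_comp; congr (\pi_tensor _).
by apply: eq_map => p /=; rewrite scalerA.
Qed.

Lemma t_scale1 : left_id 1 t_scale.
Proof.
move=> x; rewrite -[x]reprK !t_scaleE /fs_scale; congr (\pi_tensor _).
by rewrite -[RHS]map_id; apply: eq_map => -[a b] /=; rewrite scale1r.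
Qed.

Lemma t_scale0l x : t_scale 0 x = t_zero.
Proof.
elim/t_ind: x => [|a b x IHx]; first exact: t_scale0.
by rewrite t_scaleDr IHx -t_tensZl scale0r t_tens0l t_add0.
Qed.

Lemma t_addN : left_inverse t_zero t_opp t_add.
Proof.
move=> x; rewrite -[X in t_add _ X]t_scale1 /t_opp -t_scaleDl addNr.
exact: t_scale0l.
Qed.

HB.instance Definition _ :=
  GRing.isZmodule.Build tensor t_addA t_addC t_add0 t_addN.
HB.instance Definition _ :=
  GRing.Zmodule_isLmodule.Build F tensor t_scaleA t_scale1 t_scaleDr t_scaleDl.

Lemma t_mulA : associative t_mul.
Proof.
move=> x y z; rewrite -[x]reprK -[y]reprK -[z]reprK.
by rewrite !t_mulE fs_mulA.
Qed.

Lemma t_mulC : commutative t_mul.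
Proof.
move=> x y; rewrite -[x]reprK -[y]reprK !t_mulE.
by apply: tens_ext; exact: fs_mulC.
Qed.

Lemma t_mul1 : left_id t_one t_mul.
Proof.
move=> x; rewrite -[x]reprK t_mulE /fs_mul allpairs1l; congr (\pi_tensor _).
by rewrite -[RHS]map_id; apply: eq_map => -[a b] /=; rewrite !mul1r.
Qed.

Lemma t_mulDl : left_distributive t_mul +%R.
Proof.
move=> x y z; rewrite -[x]reprK -[y]reprK -[z]reprK.
by rewrite {1}/GRing.add /= t_addE !t_mulE fs_mul_catl -t_addE.
Qed.

Lemma pi_tensD s t : \pi_tensor s + \pi_tensor t = \pi_tensor (s ++ t).
Proof. exact: t_addE. Qed.

Lemma pi_tensZ c s : c *: \pi_tensor s = \pi_tensor (fs_scale c s).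
Proof. exact: t_scaleE. Qed.

Section Lift.
Variables (V : lmodType F) (beta : A -> B -> V).
Hypothesis betaDl : forall b, {morph beta^~ b : a a' / a + a'}.
Hypothesis betaDr : forall a, {morph beta a : b b' / b + b'}.
Hypothesis betaZl : forall c a b, beta (c *: a) b = c *: beta a b.
Hypothesis betaZr : forall c a b, beta a (c *: b) = c *: beta a b.

Definition tens_lift (x : tensor) : V := \sum_(p <- repr x) beta p.1 p.2.

Lemma tens_lift_rel s t : tens_rel s t ->
  \sum_(p <- s) beta p.1 p.2 = \sum_(p <- t) beta p.1 p.2.
Proof.
elim=> {s t} //=.
- by move=> t s u _ -> _ ->.
- by move=> s s' t t' _ es _ et; rewrite !big_cat /= es et.
- by move=> s t; rewrite !big_cat /= addrC.
- by move=> b; rewrite big_seq1 big_nil /= -[0 : A](scale0r 0) betaZl scale0r.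
- by move=> a a' b; rewrite !(big_cons, big_nil) /= !addr0 betaDl.
- by move=> a b b'; rewrite !(big_cons, big_nil) /= !addr0 betaDr.
- by move=> c a b; rewrite !big_seq1 /= betaZl betaZr.
Qed.

Lemma tens_liftE s : tens_lift (\pi_tensor s) = \sum_(p <- s) beta p.1 p.2.
Proof. by apply: tens_lift_rel; exact: tens_reprK. Qed.

Lemma tens_lift_tens a b : tens_lift (tens a b) = beta a b.
Proof. by rewrite tens_liftE big_seq1. Qed.

Lemma tens_lift_linear : linear tens_lift.
Proof.
move=> c x y; rewrite -[x]reprK -[y]reprK.
rewrite pi_tensZ pi_tensD !tens_liftE big_cat /= big_map scaler_sumr; congr (_ + _).
by apply: eq_bigr => p _; rewrite betaZl.
Qed.

End Lift.

Lemma t_one_neq0 : t_one != 0.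
Proof.
have [f [f_lin f1]] := exists_unit_functional A.
have [g [g_lin g1]] := exists_unit_functional B.
have fD : {morph f : x y / x + y}.
  by move=> x y; have := f_lin 1 x y; rewrite scale1r mul1r.
have gD : {morph g : x y / x + y}.
  by move=> x y; have := g_lin 1 x y; rewrite scale1r mul1r.
have f0 : f 0 = 0 by apply/(addrI (f 0)); rewrite -fD !addr0.
have g0 : g 0 = 0 by apply/(addrI (g 0)); rewrite -gD !addr0.
have fZ c x : f (c *: x) = c * f x by rewrite -[_ *: _]addr0 f_lin f0 addr0.
have gZ c x : g (c *: x) = c * g x by rewrite -[_ *: _]addr0 g_lin g0 addr0.
pose beta a b : F^o := f a * g b.
have bDl b : {morph beta^~ b : a a' / a + a'}.
  by move=> a a'; rewrite /beta fD mulrDl.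
have bDr a : {morph beta a : b b' / b + b'}.
  by move=> b b'; rewrite /beta gD mulrDr.
have bZl c a b : beta (c *: a) b = c *: beta a b by rewrite /beta fZ -mulrA.
have bZr c a b : beta a (c *: b) = c *: beta a b by rewrite /beta gZ mulrCA.
apply/eqP => one0; suff /eqP : beta 1 1 = 0 by rewrite /beta f1 g1 mulr1 oner_eq0.
rewrite -(tens_lift_tens bDl bDr bZl bZr) -/t_one one0.
by rewrite (tens_liftE bDl bDr bZl bZr [::]) big_nil.
Qed.

HB.instance Definition _ := GRing.Zmodule_isComNzRing.Build tensor
  t_mulA t_mulC t_mul1 t_mulDl t_one_neq0.

Lemma pi_tensM s t : \pi_tensor s * \pi_tensor t = \pi_tensor (fs_mul s t).
Proof. exact: t_mulE. Qed.

Lemma t_scalerAl c (x y : tensor) : c *: (x * y) = c *: x * y.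
Proof.
rewrite -[x]reprK -[y]reprK pi_tensM !pi_tensZ pi_tensM.
by rewrite fs_mul_scale.
Qed.

HB.instance Definition _ := GRing.Lmodule_isLalgebra.Build F tensor t_scalerAl.
HB.instance Definition _ := GRing.Lalgebra_isComAlgebra.Build F tensor.

Lemma tensDl a a' b : tens (a + a') b = tens a b + tens a' b.
Proof. exact: t_tensDl. Qed.

Lemma tensDr a b b' : tens a (b + b') = tens a b + tens a b'.
Proof. exact: t_tensDr. Qed.

Lemma tensZl c a b : tens (c *: a) b = c *: tens a b.
Proof. exact: t_tensZl. Qed.

Lemma tensZr c a b : tens a (c *: b) = c *: tens a b.
Proof. exact: t_tensZr. Qed.

Lemma tensM a a' b b' : tens a b * tens a' b' = tens (a * a') (b * b').
Proof. by rewrite pi_tensM. Qed.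

Lemma tens1 : tens 1 1 = 1.
Proof. by []. Qed.

Lemma tensor_ind (P : tensor -> Prop) :
    P 0 -> (forall a b x, P x -> P (tens a b + x)) ->
  forall x, P x.
Proof. exact: t_ind. Qed.

End Tensor.

Arguments tensor {F} A B.
Arguments tens {F A B} a b.

Section QuotientAlgebra.
Variables (F : fieldType) (A : comAlgType F) (I : idealr A).
Local Notation Q := {ideal_quot I}.

Definition quot_scale (c : F) := lift_op1 Q ( *:%R c).

Lemma pi_quotZ c (x : A) : quot_scale c (\pi_Q x) = \pi_Q (c *: x).
Proof.
unlock quot_scale; apply/eqP; rewrite -Quotient.idealrBE -scalerBr.
by rewrite -mulr_algl idealMr // Quotient.idealrBE reprK.
Qed.

Lemma quot_scaleA c d x : quot_scale c (quot_scale d x) = quot_scale (c * d) x.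
Proof. by rewrite -[x]reprK !pi_quotZ scalerA. Qed.

Lemma quot_scale1 : left_id 1 quot_scale.
Proof. by move=> x; rewrite -[x]reprK pi_quotZ scale1r. Qed.

Lemma quot_scaleDr : right_distributive quot_scale +%R.
Proof.
by move=> c x y; rewrite -[x]reprK -[y]reprK -rmorphD !pi_quotZ -rmorphD scalerDr.
Qed.

Lemma quot_scaleDl x : {morph quot_scale^~ x : c d / c + d}.
Proof.
by move=> c d; rewrite -[x]reprK !pi_quotZ -rmorphD scalerDl.
Qed.

HB.instance Definition _ := GRing.Zmodule_isLmodule.Build F {ideal_quot I}
  quot_scaleA quot_scale1 quot_scaleDr quot_scaleDl.

Lemma quot_scalerAl c (x y : Q) : c *: (x * y) = c *: x * y.
Proof.
rewrite -[x]reprK -[y]reprK -rmorphM !/(_ *: _) /= !pi_quotZ -rmorphM.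
by rewrite scalerAl.
Qed.

HB.instance Definition _ :=
  GRing.Lmodule_isLalgebra.Build F {ideal_quot I} quot_scalerAl.
HB.instance Definition _ := GRing.Lalgebra_isComAlgebra.Build F {ideal_quot I}.

End QuotientAlgebra.


Section Kleinian.
Variables (K : fieldType) (n : nat).

Definition XYZ_rel : {mpoly K[3]} := 'X_0 * 'X_1 - 'X_2 ^+ n.

Definition XYZ_ideal : {mpoly K[3]} -> bool :=
  fun p => `[< exists q, p = q * XYZ_rel >].

Lemma XYZ_idealr_closed : idealr_closed XYZ_ideal.
Proof.
split; first by apply/asboolP; exists 0; rewrite mul0r.
  apply/asboolP => -[q /(congr1 (meval (fun=> 1)))].
  rewrite mevalM mevalB mevalM rmorphXn /= !mevalXU expr1n mulr1 subrr mulr0 meval1.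
  by move/eqP; rewrite oner_eq0.
move=> a _ _ /asboolP[q ->] /asboolP[q' ->]; apply/asboolP.
by exists (a * q + q'); rewrite mulrDl mulrA.
Qed.
HB.instance Definition _ := isIdealr.Build _ XYZ_ideal XYZ_idealr_closed.

Definition XYZ_ring : comAlgType K :=
  {ideal_quot (XYZ_ideal : idealr {mpoly K[3]})}.

Definition XYZ_class (p : {mpoly K[3]}) : XYZ_ring :=
  \pi_{ideal_quot (XYZ_ideal : idealr {mpoly K[3]})} p.

End Kleinian.

(** [{mpoly K[nvars n P]}] is [K[x_ij | P i j]] with [i] and [j] in [0..n];
   in all uses [P] forces [1 <= i, j], so the indices are those of the usual
   1-based convention. *)
Definition xidx (n : nat) (P : rel nat) :=
  {p : 'I_n.+1 * 'I_n.+1 | P p.1 p.2}.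

Definition nvars (n : nat) (P : rel nat) : nat := #|{: xidx n P}|.

(** [xvar i j] is meaningful (and nonzero) only when [P i j] holds. *)
Definition xvar {K : fieldType} {n : nat} {P : rel nat} (i j : nat) :
    {mpoly K[nvars n P]} :=
  if [pick t : xidx n P | ((val t).1 == i :> nat) && ((val t).2 == j :> nat)]
  is Some t then 'X_(enum_rank t) else 0.

Definition below_diag : rel nat := fun i j => (1 <= j < i)%N.
Definition col2_vars (n : nat) : rel nat :=
  fun i j => ((3 <= i <= n - 1) && (j == 2))%N.
Definition right_vars : rel nat := fun i j => (3 <= j < i)%N.

Record hessfun (n : nat) := HessFun {
  hess_fun :> nat -> nat;
  hess_fun_range : forall j, (1 <= j <= n)%N -> (j <= hess_fun j <= n)%N;
  hess_fun_mono : forall i j,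
    (1 <= i)%N -> (i <= j <= n)%N -> (hess_fun i <= hess_fun j)%N }.

Definition h2_fun (n : nat) (j : nat) : nat := (if j == 1 then 2 else n)%N.

Lemma h2_range n (hn : (3 <= n)%N) j :
  (1 <= j <= n)%N -> (j <= h2_fun n j <= n)%N.
Proof.
rewrite /h2_fun; case: eqP => [->|_] /andP[_ jn]; last by rewrite jn leqnn.
by rewrite /= ltnW.
Qed.

Lemma h2_mono n (hn : (3 <= n)%N) i j :
  (1 <= i)%N -> (i <= j <= n)%N -> (h2_fun n i <= h2_fun n j)%N.
Proof.
rewrite /h2_fun; case: eqP => [_|i1]; case: eqP => [j1|_] //.
  by move=> _ _; rewrite ltnW.
by rewrite j1; case: i i1 => [|[|i]].
Qed.

Definition h2 n (hn : (3 <= n)%N) : hessfun n := HessFun (h2_range hn) (h2_mono hn).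

Section Flags.
Variables (K : closedFieldType) (n : nat).

(** A full flag is a family [V_0 = 0, V_1, ..., V_n] indexed by ['I_n.+1], so
   that [V_i] has dimension [i]. Rows and columns of matrices are indexed by
   ['I_n], hence shifted by one. *)
Definition family := {ffun 'I_n.+1 -> {vspace 'cV[K]_n}}.

Definition Fl : set family :=
  [set V : family | (forall i : 'I_n.+1, \dim (V i) = i) /\
     (forall i j : 'I_n.+1, (i <= j)%N -> (V i <= V j)%VS)]%classic.

Definition flag_of (g : 'M[K]_n) : family :=
  [ffun j : 'I_n.+1 => <<[seq col k g | k : 'I_n <- enum 'I_n & (k < j)%N]>>%VS].

Definition mx_act (g : 'M[K]_n) (V : family) : family :=
  [ffun j => (linfun (mulmx g) @: V j)%VS].

Definition opp_cell : set family :=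
  [set V : family | exists b : 'M[K]_n,
     [/\ is_trig_mx b, b \in unitmx & V = mx_act b (flag_of 1%:M)]]%classic.

Definition nilp : 'M[K]_n := \matrix_(i, j) (i.+1 == j :> nat)%:R.

Definition Hess (A : 'M[K]_n) (h : nat -> nat) : set family :=
  [set V : family | Fl V /\ forall i : 'I_n.+1, (1 <= i)%N ->
     (linfun (mulmx A) @: V i <= V (inord (h i)))%VS]%classic.

Definition hess_cell (h : hessfun n) : set family :=
  (Hess nilp h `&` opp_cell)%classic.

(** The opposite cell consists of the flags of lower triangular unipotent
   matrices; [generic_unip] is the matrix [(x_ij)] of its coordinate functions
   and [unip v] the point with coordinates [v]. *)
Definition generic_unip : 'M[{mpoly K[nvars n below_diag]}]_n :=
  \matrix_(i, j) if i == j then 1 else xvar i.+1 j.+1.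

Definition unip (v : 'I_(nvars n below_diag) -> K) : 'M[K]_n :=
  map_mx (meval v) generic_unip.

(** The ideal of the reduced closed subvariety [Hess(N,h)] of the cell. *)
Definition hess_ideal (h : hessfun n) : {mpoly K[nvars n below_diag]} -> bool :=
  fun p => `[< forall v, hess_cell h (flag_of (unip v)) -> p.@[v] = 0 >].

Lemma xvar_meval0 P i j : (xvar i j : {mpoly K[nvars n P]}).@[fun=> 0] = 0.
Proof. by rewrite /xvar; case: pickP => [t _|_]; rewrite ?meval0 ?mevalXU. Qed.

Lemma unip0 : unip (fun=> 0) = 1%:M.
Proof.
apply/matrixP => i j; rewrite !mxE; case: eqP => _; first exact: meval1.
exact: xvar_meval0.
Qed.

Lemma free_col1 (s : seq 'I_n) : uniq s -> free [seq col k (1%:M : 'M[K]_n) | k <- s].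
Proof.
elim: s => [|k s IHs] /=; first by rewrite nil_free.
move=> /andP[ks us]; rewrite free_cons IHs // andbT; apply/negP.
move=> /(@coord_span _ _ _ (in_tuple _)) /(congr1 (fun v : 'cV_n => v k ord0)).
rewrite !mxE eqxx summxE big1 => [/eqP|i _]; first by rewrite oner_eq0.
have {}i_s : (i < size s)%N by rewrite -(size_map (fun k => col k (1%:M : 'M[K]_n))).
rewrite mxE (nth_map k) // !mxE; case: eqP => [ki|_]; last by rewrite mulr0.
by rewrite ki mem_nth in ks.
Qed.

Lemma dim_flag1 (j : 'I_n.+1) : \dim (flag_of 1%:M j) = j.
Proof.
rewrite ffunE; have /eqP -> := free_col1 (filter_uniq (fun k : 'I_n => (k < j)%N) (enum_uniq 'I_n)).
rewrite size_map size_filter -(count_map val (fun k => (k < j)%N)) val_enum_ord.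
have : (j <= n)%N by rewrite -ltnS.
move: (val j) => {}j jn; rewrite -(subnKC jn) iotaD count_cat add0n (@eq_in_count _ _ predT).
  rewrite count_predT size_iota (@eq_in_count _ _ pred0) ?count_pred0 ?addn0 //.
  by move=> k; rewrite mem_iota => /andP[jk _]; rewrite /= ltnNge jk.
by move=> k; rewrite mem_iota add0n => /andP[_ ->].
Qed.

Lemma Fl_flag1 : Fl (flag_of 1%:M).
Proof.
split=> [|i j ij]; first exact: dim_flag1.
rewrite !ffunE; apply: sub_span => v /mapP[k]; rewrite mem_filter => /andP[ki kn] ->.
by apply/map_f; rewrite mem_filter kn (leq_trans ki).
Qed.

Lemma hess_cell_flag1 (h : hessfun n) : hess_cell h (flag_of 1%:M).
Proof.
split; last first.
  exists 1%:M; split; first exact: scalar_mx_is_trig.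
    exact: unitmx1.
  apply/ffunP => j; rewrite [RHS]ffunE; apply/esym.
  rewrite (_ : linfun _ = \1%VF); first by rewrite lim1g.
  by apply/lfunP => v; rewrite !lfunE /= mul1mx.
split=> [|i i1]; first exact: Fl_flag1.
have /andP[ih hin] : (i <= h i <= n)%N.
  by apply: hess_fun_range; rewrite i1 leq_ord.
rewrite [flag_of _ i]ffunE limg_span; apply/span_subvP => _ /mapP[_ /mapP[k + ->] ->].
rewrite mem_filter lfunE /= => /andP[ki _]; rewrite [col k _]colE mul1mx -colE.
case: k ki => -[|k] kn /= ki.
  rewrite [col _ _](_ : _ = 0) ?mem0v //.
  by apply/colP => l; rewrite !mxE.
have kn' := ltnW kn.
rewrite [col _ _](_ : _ = col (Ordinal kn') 1%:M).
  rewrite ffunE; apply/memv_span/map_f; rewrite mem_filter mem_enum /= andbT.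
  by rewrite inordK ?ltnS // (leq_trans _ ih) // ltnW.
by apply/colP => l; rewrite !mxE eqSS.
Qed.

Lemma hess_idealr_closed h : idealr_closed (hess_ideal h).
Proof.
split; first by apply/asboolP => v _; rewrite meval0.
  apply/asboolP => /(_ (fun=> 0)); rewrite unip0 meval1.
  by move=> /(_ (hess_cell_flag1 h))/eqP; rewrite oner_eq0.
move=> a p q /asboolP p0 /asboolP q0; apply/asboolP => v hv.
by rewrite mevalD mevalM p0 // q0 // mulr0 addr0.
Qed.
HB.instance Definition _ h :=
  isIdealr.Build _ (hess_ideal h) (hess_idealr_closed h).

Definition hess_ring (h : hessfun n) : comAlgType K :=
  {ideal_quot (hess_ideal h : idealr {mpoly K[nvars n below_diag]})}.

Definition hess_x (h : hessfun n) (i j : nat) : hess_ring h :=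
  \pi_{ideal_quot (hess_ideal h : idealr {mpoly K[nvars n below_diag]})} (xvar i j).

End Flags.


(** An affine variety is determined by its points together with its global
   regular functions, and the isomorphisms of affine varieties are the
   bijections that identify the regular functions on both sides. *)

Record variety (K : fieldType) := Variety {
  pts :> Type;
  regular : (pts -> K) -> Prop }.

Definition var_iso (K : fieldType) (X Y : variety K) : Prop :=
  exists phi : X -> Y,
    bijective phi /\ forall f : Y -> K, regular f <-> regular (f \o phi).

Definition affine_space (K : fieldType) (m : nat) : variety K :=
  @Variety K 'rV[K]_m
    (fun f => exists p : {mpoly K[m]}, forall x : 'rV[K]_m, f x = p.@[x 0]).

(** [K[X x Y]] is the image of [K[X] ⊗ K[Y]]. *)
Definition var_prod (K : fieldType) (X Y : variety K) : variety K :=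
  @Variety K (X * Y)
    (fun f => exists (r : nat) (g : 'I_r -> X -> K) (h : 'I_r -> Y -> K),
       [/\ forall k, regular (g k), forall k, regular (h k) &
           forall x y, f (x, y) = \sum_k g k x * h k y]).

(** The quotient by a finite group with orbit map [orb]: its points are the
   orbits, and a function on it is regular iff its pull-back is. *)
Definition orbits (T : Type) (orb : T -> set T) := {O : set T | exists x, O = orb x}.

Definition orbit_of (T : Type) (orb : T -> set T) (x : T) : orbits orb :=
  exist _ (orb x) (ex_intro _ x erefl).

Definition var_quot (K : fieldType) (X : variety K) (orb : X -> set X) : variety K :=
  @Variety K (orbits orb) (fun f => regular (fun x : X => f (orbit_of orb x))).

Definition cyclic_act (K : fieldType) (zeta : K) (k : nat) (p : 'rV[K]_2) : 'rV[K]_2 :=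
  \row_i if i == 0 then zeta ^+ k * p 0 0 else zeta ^- k * p 0 1.

Definition cyclic_orbit (K : fieldType) (zeta : K) (p : 'rV[K]_2) : set 'rV[K]_2 :=
  [set q | exists k : nat, q = cyclic_act zeta k p]%classic.

Definition cyclic_quotient (K : fieldType) (zeta : K) : variety K :=
  @var_quot K (affine_space K 2) (cyclic_orbit zeta).

Definition hess_variety (K : closedFieldType) (n : nat) (h : hessfun n) : variety K :=
  @Variety K {V : family K n | hess_cell h V}
    (fun f => exists p : {mpoly K[nvars n below_diag]},
       forall v (hv : hess_cell h (flag_of (unip v))), f (exist _ _ hv) = p.@[v]).

(* Main.v *)
Require Import Defs.
From HB Require Import structures.
From mathcomp Require Import all_boot all_order all_algebra.
From mathcomp Require Import boolp classical_sets reals.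
From mathcomp Require Import complex.
From mathcomp Require Import ssrcomplements mpoly.
From mathcomp Require Import ring.

(** Let g be lower triangular unipotent with first columns c = (1, x21, ..., xn1)
   and d = (0, 1, x32, ..., xn2). The flag of g lies in Hess(N, h_2) exactly when
   N c is in the span of c and d. The first two rows force
   N c = Z c - X d with Z = x21 and X = x21^2 - x31, and the other rows read
   x_{i+1,1} = Z x_{i1} - X x_{i2}, with 0 in place of x_{n+1,1}. Solving this
   recursion gives
     x_{i1} = Z^(i-1) - X (Z^(i-3) x22 + ... + x_{i-1,2}),   x22 = 1,
   so the first column is a function of X, Z and the second column, and the last
   row becomes the single equation X Y = Z^n with
   Y = Z^(n-2) + x32 Z^(n-3) + ... + xn2. Trading xn2 for Y, the cell is the
   surface X Y = Z^n times an affine space ([chart], [hess_rel_chart],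
   [chart_hess_rel], [hess_cellP]).

   The coordinate ring of the reduced variety is defined by vanishing on points,
   so injectivity of the ring map is a statement about points: an element of the
   tensor product that vanishes at every point is zero. This is inherited by
   tensor products from their factors ([tens_separating]), holds for polynomials
   because the field is infinite ([mpoly_separating]), and holds for
   K[X,Y,Z]/(XY - Z^n) because the parametrization
   (s, t) |-> (s^n, t^n, s t) sends the monomials of a normal form to distinct
   monomials ([XYZ_separating]). Surjectivity is clear from [chart], which
   expresses every coordinate through the generators ([hess_psiK]).

   For the varieties, (s, t) |-> (s^n, t^n, s t) identifies the orbits of the
   cyclic group with the points of X Y = Z^n ([cyclic_orbitE],
   [cell_pt_surj]), and a polynomial in s, t invariant under the group comes from
   K[X,Y,Z]/(XY - Z^n) ([cyclic_invariant]). *)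

Set Implicit Arguments.
Unset Strict Implicit.
Unset Printing Implicit Defensive.
Import GRing.Theory.
Local Open Scope ring_scope.
Local Open Scope quotient_scope.

(** * Morphisms out of polynomial rings, quotients and tensor products *)

Section MpolyMorphism.
Variables (F : fieldType) (m : nat) (B : comAlgType F).

Definition mpoly_mor (h : 'I_m -> B) : {mpoly F[m]} -> B := mmap (in_alg B) h.

Lemma mpoly_mor_monoid h : monoid_morphism (mpoly_mor h).
Proof. by split=> [|p q]; rewrite /mpoly_mor ?rmorph1 ?rmorphM. Qed.

Lemma mpoly_mor_linear h : linear (mpoly_mor h).
Proof. by move=> c p q; rewrite /mpoly_mor raddfD /= mmapZ mulr_algl. Qed.

HB.instance Definition _ h :=
  GRing.isLinear.Build F {mpoly F[m]} B _ (mpoly_mor h) (mpoly_mor_linear h).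
HB.instance Definition _ h :=
  GRing.isMonoidMorphism.Build {mpoly F[m]} B (mpoly_mor h)
    (mpoly_mor_monoid h).

Lemma mpoly_morX h i : mpoly_mor h 'X_i = h i.
Proof. by rewrite /mpoly_mor mmapX mmap1U. Qed.

Lemma mpoly_linear_ext (V : lmodType F) (f g : {linear {mpoly F[m]} -> V}) :
  (forall e, f 'X_[e] = g 'X_[e]) -> f =1 g.
Proof.
move=> fg p; rewrite [p]mpolyE !linear_sum /=; apply: eq_bigr => e _.
by rewrite !linearZ /= fg.
Qed.

Lemma mpoly_lrmorph_ext (f g : {lrmorphism {mpoly F[m]} -> B}) :
  (forall i, f 'X_i = g 'X_i) -> f =1 g.
Proof.
move=> fg; apply: mpoly_linear_ext => e; rewrite mpolyXE_id !rmorph_prod.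
by apply: eq_bigr => i _; rewrite !rmorphXn /= fg.
Qed.

End MpolyMorphism.

Section QuotientProjection.
Variables (F : fieldType) (A : comAlgType F) (I : idealr A).
Local Notation Q := {ideal_quot I}.

Definition quot_pi : A -> Q := \pi_Q.

Lemma quot_pi_linear : linear quot_pi.
Proof.
by move=> c a b; rewrite /quot_pi rmorphD [in RHS]/GRing.scale /= pi_quotZ.
Qed.

HB.instance Definition _ := GRing.isLinear.Build F A Q _ quot_pi quot_pi_linear.
HB.instance Definition _ :=
  GRing.isMonoidMorphism.Build A Q quot_pi (rmorphism_monoidP (\pi_Q)).

End QuotientProjection.

Section QuotientMorphism.
Variables (F : fieldType) (A B : comAlgType F) (I : idealr A).
Variable f : {lrmorphism A -> B}.
Local Notation Q := {ideal_quot I}.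

(** The vanishing hypothesis is an argument so that the morphism structure below
   can be attached to this constant. *)
Definition quot_mor of (forall a, a \in I -> f a = 0) : Q -> B :=
  fun q => f (repr q).

Hypothesis fI : forall a, a \in I -> f a = 0.

Lemma quot_mor_pi a : quot_mor fI (\pi_Q a) = f a.
Proof.
apply/eqP; rewrite -subr_eq0 -linearB; apply/eqP/fI.
by rewrite Quotient.idealrBE reprK.
Qed.

Lemma quot_mor_linear : linear (quot_mor fI).
Proof.
move=> c x y; rewrite -[x]reprK -[y]reprK {1}/GRing.scale /= pi_quotZ -rmorphD.
by rewrite !quot_mor_pi linearP.
Qed.

Lemma quot_mor_monoid : monoid_morphism (quot_mor fI).
Proof.
split=> [|x y]; first by rewrite -(rmorph1 (\pi_Q)) quot_mor_pi rmorph1.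
by rewrite -[x]reprK -[y]reprK -rmorphM !quot_mor_pi rmorphM.
Qed.

HB.instance Definition _ := GRing.isLinear.Build F Q B _ (quot_mor fI)
  quot_mor_linear.
HB.instance Definition _ :=
  GRing.isMonoidMorphism.Build Q B (quot_mor fI) quot_mor_monoid.

End QuotientMorphism.

Section TensorMorphism.
Variables (F : fieldType) (A B D : comAlgType F).
Variables (f : {lrmorphism A -> D}) (g : {lrmorphism B -> D}).

Let beta a b := f a * g b.
Let betaDl b : {morph beta^~ b : a a' / a + a'}.
Proof. by move=> a a'; rewrite /beta raddfD mulrDl. Qed.
Let betaDr a : {morph beta a : b b' / b + b'}.
Proof. by move=> b b'; rewrite /beta raddfD mulrDr. Qed.
Let betaZl c a b : beta (c *: a) b = c *: beta a b.
Proof. by rewrite /beta linearZ /= scalerAl. Qed.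
Let betaZr c a b : beta a (c *: b) = c *: beta a b.
Proof. by rewrite /beta linearZ /= scalerAr. Qed.

Definition tens_mor : tensor A B -> D := tens_lift (fun a b => f a * g b).

Lemma tens_mor_pi s :
  tens_mor (\pi_(tensor A B) s) = \sum_(p <- s) f p.1 * g p.2.
Proof. exact: (tens_liftE betaDl betaDr betaZl betaZr). Qed.

Lemma tens_morE a b : tens_mor (tens a b) = f a * g b.
Proof. by rewrite tens_mor_pi big_seq1. Qed.

Lemma tens_mor_linear : linear tens_mor.
Proof. exact: (tens_lift_linear betaDl betaDr betaZl betaZr). Qed.

Lemma tens_mor_monoid : monoid_morphism tens_mor.
Proof.
split=> [|x y]; first by rewrite -tens1 tens_morE !rmorph1 mulr1.
rewrite -[x]reprK -[y]reprK pi_tensM !tens_mor_pi mulr_suml.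
rewrite big_allpairs_dep; apply: eq_bigr => p _; rewrite mulr_sumr.
by apply: eq_bigr => q _; rewrite !rmorphM mulrACA.
Qed.

HB.instance Definition _ :=
  GRing.isLinear.Build F (tensor A B) D _ tens_mor tens_mor_linear.
HB.instance Definition _ :=
  GRing.isMonoidMorphism.Build (tensor A B) D tens_mor tens_mor_monoid.

End TensorMorphism.

Arguments mpoly_mor : simpl never.
Arguments quot_mor : simpl never.
Arguments tens_mor : simpl never.

Section Inclusions.
Variables (F : fieldType) (A B : comAlgType F).

Definition tens_inl (a : A) : tensor A B := tens a 1.
Definition tens_inr (b : B) : tensor A B := tens 1 b.

Lemma tens_inl_linear : linear tens_inl.
Proof. by move=> c a a'; rewrite /tens_inl tensDl tensZl. Qed.
Lemma tens_inr_linear : linear tens_inr.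
Proof. by move=> c b b'; rewrite /tens_inr tensDr tensZr. Qed.
Lemma tens_inl_monoid : monoid_morphism tens_inl.
Proof. by split=> [|a a'] //; rewrite /tens_inl tensM mulr1. Qed.
Lemma tens_inr_monoid : monoid_morphism tens_inr.
Proof. by split=> [|b b'] //; rewrite /tens_inr tensM mulr1. Qed.

HB.instance Definition _ :=
  GRing.isLinear.Build F A (tensor A B) _ tens_inl tens_inl_linear.
HB.instance Definition _ :=
  GRing.isMonoidMorphism.Build A (tensor A B) tens_inl tens_inl_monoid.
HB.instance Definition _ :=
  GRing.isLinear.Build F B (tensor A B) _ tens_inr tens_inr_linear.
HB.instance Definition _ :=
  GRing.isMonoidMorphism.Build B (tensor A B) tens_inr tens_inr_monoid.

End Inclusions.

(** * Separation of elements by points *)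

Definition separating (F : fieldType) (S : Type) (A : comAlgType F)
    (ev : S -> {lrmorphism A -> F^o}) : Prop :=
  forall a, (forall s, ev s a = 0) -> a = 0.

Lemma pi_tens_sum (F : fieldType) (A B : comAlgType F) (s : seq (A * B)) :
  \pi_(tensor A B) s = \sum_(p <- s) tens p.1 p.2.
Proof.
elim: s => [|[a b] s IHs]; first by rewrite big_nil.
by rewrite big_cons -IHs -cat1s -pi_tensD.
Qed.

Lemma tens_suml (F : fieldType) (A B : comAlgType F) I (s : seq I) (f : I -> A)
    (b : B) :
  tens (\sum_(i <- s) f i) b = \sum_(i <- s) tens (f i) b.
Proof.
elim: s => [|i s IHs]; last by rewrite !big_cons tensDl IHs.
by rewrite !big_nil -(scale0r 0) tensZl scale0r.
Qed.

Lemma tens_lrmorph_ext (F : fieldType) (A B D : comAlgType F)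
    (f g : {lrmorphism tensor A B -> D}) :
  (forall a, f (tens a 1) = g (tens a 1)) ->
  (forall b, f (tens 1 b) = g (tens 1 b)) -> f =1 g.
Proof.
have split (e : {lrmorphism tensor A B -> D}) a b :
    e (tens a b) = e (tens a 1) * e (tens 1 b).
  by rewrite -rmorphM tensM mulr1 mul1r.
move=> fgA fgB x; rewrite -[x]reprK pi_tens_sum !linear_sum;
  apply: eq_bigr => p _ /=.
by rewrite split fgA fgB -split.
Qed.

(** By induction on the number of summands. If b(s') <> 0 for the second factor
   of the first summand, evaluating at s' turns the vanishing of the sum into a
   linear relation between the first factors, which removes that summand. *)
Lemma tens_separating (F : fieldType) (S S' : Type) (A B : comAlgType F)
    (evA : S -> {lrmorphism A -> F^o}) (evB : S' -> {lrmorphism B -> F^o}) :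
  separating evA -> separating evB ->
  separating (fun p : S * S' =>
    tens_mor (evA p.1) (evB p.2) : {lrmorphism tensor A B -> F^o}).
Proof.
move=> sepA sepB x; rewrite -[x]reprK; set s := repr x; move: s => {x} s.
move sz: (size s) => k; elim: k s sz => [|k IHk] s.
  by move/size0nil => -> _.
case: s => //= -[a b] s [sz] ev0.
have [b0|/eqP bn0] := pselect (b = 0).
  have e : \pi_(tensor A B) ((a, b) :: s) = \pi_(tensor A B) s.
    rewrite !pi_tens_sum big_cons /= b0 -(scale0r (0 : B)) tensZr scale0r.
    by rewrite add0r.
  by rewrite e; apply: IHk => // p; rewrite -e; exact: ev0.
have [s' bs'] : exists s', evB s' b != 0.
  apply: contrapT => nex; move/eqP: bn0; apply; apply: sepB => s'.
  by apply/eqP/negPn/negP => bs'; apply: nex; exists s'.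
pose c p := (evB s' p / evB s' b : F).
(* sepA applies to the first factors, with the second ones evaluated at s' *)
have aE : a = - \sum_(p <- s) c p.2 *: p.1.
  apply/eqP; rewrite -addr_eq0; apply/eqP/sepA => s0.
  have := ev0 (s0, s');
    rewrite tens_mor_pi big_cons /= => /(congr1 ( *%R (evB s' b : F)^-1)).
  rewrite mulr0 mulrDr [X in X + _]mulrC mulfK // mulr_sumr => <-.
  rewrite raddfD raddf_sum /=; congr (_ + _); apply: eq_bigr => p _.
  by rewrite linearZ /= /c /GRing.scale /=; ring.
have e : \pi_(tensor A B) ((a, b) :: s) =
    \pi_(tensor A B) [seq (p.1, p.2 - c p.2 *: b) | p <- s].
  rewrite !pi_tens_sum big_cons big_map /= aE -scaleN1r tensZl tens_suml.
  rewrite scaler_sumr -big_split; apply: eq_bigr => p _ /=.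
  by rewrite -scaleN1r tensDr !tensZr tensZl addrC.
by rewrite e; apply: IHk; [rewrite size_map | move=> p; rewrite -e; exact: ev0].
Qed.

(** Monomials are characters of the multiplicative monoid of points, and distinct
   characters are linearly independent (Artin): comparing the relation at u v
   with mon u e0 times the relation at v eliminates e0. *)
Lemma mpoly_separating (F : closedFieldType) (m : nat) :
  separating (fun v : 'I_m -> F => meval v : {lrmorphism {mpoly F[m]} -> F^o}).
Proof.
pose mon (v : 'I_m -> F) (e : 'X_{1..m}) := \prod_i v i ^+ e i.
have monM u v e : mon (fun i => u i * v i) e = mon u e * mon v e.
  by rewrite -big_split; apply: eq_bigr => i _; rewrite exprMn.
suff indep (s : seq 'X_{1..m}) (c : 'X_{1..m} -> F) : uniq s ->
    (forall v, \sum_(e <- s) c e * mon v e = 0) -> forall e, e \in s -> c e = 0.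
  move=> p p0; rewrite [p]mpolyE big_seq big1 // => e ep.
  rewrite (indep (msupp p) (fun e => p@_e)) ?scale0r //.
elim: s c => [|e0 s IHs] //= c /andP[e0s us] s0.
have {}IHs e : e \in s -> c e = 0.
  move=> es; have [i ei] : exists i, e i != e0 i.
    apply: contrapT => nex; move: e0s; suff <- : e = e0 by rewrite es.
    by apply/mnmP => i; apply/eqP/negPn/negP => ei; apply: nex; exists i.
  have : 'X^(e i) - 'X^(e0 i) != 0 :> {poly F}.
    apply: contra ei => /eqP/(congr1 (fun q : {poly F} => q`_(e i))).
    rewrite coefB !coefXn eqxx coef0; case: eqP => // _ /eqP.
    by rewrite subr0 oner_eq0.
  case/closed_nonrootP => t; rewrite /root !hornerE => te.
  (* u separates the characters e and e0 *)
  pose u j := if j == i then t else 1.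
  have monu e' : mon u e' = t ^+ e' i.
    rewrite /mon (bigD1 i) //= /u eqxx big1 ?mulr1 // => j /negPf ->.
    by rewrite expr1n.
  have /IHs : forall v, \sum_(e <- s) c e * (mon u e - mon u e0) * mon v e = 0.
    move=> v; have := s0 v; have := s0 (fun i => u i * v i).
    rewrite !big_cons monM; set B := \sum_(e <- s) _; set A := \sum_(e <- s) _.
    move=> e2 e1.
    transitivity (B - mon u e0 * A).
      rewrite mulr_sumr -sumrB; apply: eq_bigr => e' _.
      by rewrite monM; ring.
    by rewrite -(addr0_eq e2) -(addr0_eq e1); ring.
  move/(_ us e es)/eqP; rewrite mulf_eq0 !monu (negPf te) orbF => /eqP; exact.
move=> e; rewrite inE => /orP[/eqP ->|]; last exact: IHs.
have := s0 (fun=> 1); rewrite big_cons big_seq big1 ?addr0 => [|e' /IHs ->].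
  by rewrite /mon big1 ?mulr1 // => i _; rewrite expr1n.
by rewrite mul0r.
Qed.

(** * The Kleinian singularity and invariants of the cyclic group *)

Section MpolyLift.
Variables (F : fieldType) (m : nat) (V : lmodType F) (f : 'X_{1..m} -> V).

Definition mpoly_lift (p : {mpoly F[m]}) : V := \sum_(e <- msupp p) p@_e *: f e.

Lemma mpoly_lift_linear : linear mpoly_lift.
Proof.
have liftE (p : {mpoly F[m]}) i : (msize p <= i)%N ->
    mpoly_lift p = \sum_(e : 'X_{1..m < i}) p@_e *: f e.
  move=> p_i; rewrite /mpoly_lift (big_mksub 'X_{1..m < i}) ?msupp_uniq //=.
    by rewrite big_rmcond // => e /memN_msupp_eq0 ->; rewrite scale0r.
  by move=> e /msize_mdeg_lt /leq_trans; exact.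
move=> c p q; pose i := maxn (msize (c *: p + q)) (maxn (msize p) (msize q)).
rewrite !(@liftE _ i) ?leq_max ?leqnn ?orbT // scaler_sumr -big_split.
by apply: eq_bigr => e _; rewrite mcoeffD mcoeffZ scalerDl scalerA.
Qed.

HB.instance Definition _ :=
  GRing.isLinear.Build F {mpoly F[m]} V _ mpoly_lift mpoly_lift_linear.

Lemma mpoly_liftX e : mpoly_lift 'X_[e] = f e.
Proof. by rewrite /mpoly_lift msuppX big_seq1 mcoeffX eqxx scale1r. Qed.

End MpolyLift.

Definition vec2 (A : zmodType) (x y : A) : 'I_2 -> A := fun i => [:: x; y]`_i.
Definition vec3 (A : zmodType) (x y z : A) : 'I_3 -> A := fun i => [:: x; y;
  z]`_i.

Lemma vec2E (A : zmodType) (v : 'I_2 -> A) : v =1 vec2 (v 0) (v 1).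
Proof. by case=> -[|[|//]] i2; congr v; apply: val_inj. Qed.

Section KleinianRing.
Variables (K : closedFieldType) (n : nat).
Hypothesis n_gt0 : (0 < n)%N.
Local Notation A := (XYZ_ring K n).
Local Notation cX := (XYZ_class n 'X_0 : A).
Local Notation cY := (XYZ_class n 'X_1 : A).
Local Notation cZ := (XYZ_class n 'X_2 : A).


HB.instance Definition _ := GRing.LRMorphism.copy (@XYZ_class K n)
  (quot_pi (XYZ_ideal n : idealr {mpoly K[3]})).

Lemma XYZ_classE (p : {mpoly K[3]}) :
  XYZ_class n p = mpoly_mor (vec3 cX cY cZ) p.
Proof.
apply: (mpoly_lrmorph_ext (f := XYZ_class n)) => i.
transitivity (vec3 cX cY cZ i); last by rewrite -mpoly_morX.
case: i => -[|[|[|//]]] i3; rewrite /vec3 /=;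
  by congr (XYZ_class n 'X__); apply: val_inj.
Qed.

Lemma XYZ_classM : cX * cY = cZ ^+ n.
Proof.
apply/eqP; rewrite -rmorphM -rmorphXn -Quotient.idealrBE.
by apply/asboolP; exists 1; rewrite mul1r.
Qed.

Lemma XYZ_lrmorph_ext (B : comAlgType K) (f g : {lrmorphism A -> B}) :
  f cX = g cX -> f cY = g cY -> f cZ = g cZ -> f =1 g.
Proof.
move=> f0 f1 f2 a; rewrite -[a]reprK.
pose f' : {lrmorphism {mpoly K[3]} -> B} := f \o @XYZ_class K n.
pose g' : {lrmorphism {mpoly K[3]} -> B} := g \o @XYZ_class K n.
suff fg : f' =1 g' by exact: fg.
apply: mpoly_lrmorph_ext => -[[|[|[|//]]] i3]; rewrite /f' /g' /=.
- by rewrite (_ : Ordinal i3 = 0) //; apply: val_inj.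
- by rewrite (_ : Ordinal i3 = 1) //; apply: val_inj.
- by rewrite (_ : Ordinal i3 = 2%:R) //; apply: val_inj.
Qed.

Section Universal.
Variables (B : comAlgType K) (x y z : B).
Hypothesis xyz : x * y = z ^+ n.

Lemma XYZ_killed p : p \in (XYZ_ideal n : idealr {mpoly K[3]}) ->
  mpoly_mor (vec3 x y z) p = 0.
Proof.
move/asboolP => [q ->]; rewrite rmorphM rmorphB rmorphM rmorphXn /= !mpoly_morX.
by rewrite /vec3 /= xyz subrr mulr0.
Qed.

Definition XYZ_mor : A -> B := quot_mor XYZ_killed.
HB.instance Definition _ := GRing.LRMorphism.on XYZ_mor.

Lemma XYZ_morE p : XYZ_mor (XYZ_class n p) = mpoly_mor (vec3 x y z) p.
Proof. exact: quot_mor_pi. Qed.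

End Universal.

Definition orbifold_ev (p : K * K) : A -> K^o :=
  XYZ_mor (esym (exprMn n p.1 p.2) : (p.1 ^+ n : K^o) * p.2 ^+ n = (p.1 * p.2)
    ^+ n).
HB.instance Definition _ p := GRing.LRMorphism.on (orbifold_ev p).

Lemma orbifold_evE p q :
  orbifold_ev p (XYZ_class n q) = mpoly_mor (vec3 (p.1 ^+ n : K^o) (p.2 ^+ n)
    (p.1 * p.2)) q.
Proof. exact: XYZ_morE. Qed.

Lemma orbifold_evX p : orbifold_ev p cX = p.1 ^+ n.
Proof. by rewrite orbifold_evE mpoly_morX. Qed.
Lemma orbifold_evY p : orbifold_ev p cY = p.2 ^+ n.
Proof. by rewrite orbifold_evE mpoly_morX. Qed.
Lemma orbifold_evZ p : orbifold_ev p cZ = p.1 * p.2.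
Proof. by rewrite orbifold_evE mpoly_morX. Qed.

(** The normal form in K[X,Y,Z]/(XY - Z^n) of the monomial that pulls back to
   s^(e 0) t^(e 1); at most one of the two truncated differences is
   nonzero. This is meant for e 0 and e 1 congruent modulo n. *)
Definition section_monomial (e : 'X_{1..2}) : A :=
  cX ^+ ((e 0 - e 1) %/ n) * cY ^+ ((e 1 - e 0) %/ n) * cZ ^+ minn (e 0) (e 1).

Lemma section_monomialE (a b c : nat) (e : 'X_{1..2}) :
  e 0 = (n * a + c)%N -> e 1 = (n * b + c)%N ->
  section_monomial e = cX ^+ a * cY ^+ b * cZ ^+ c.
Proof.
rewrite /section_monomial => -> ->.
rewrite !subnDr -!mulnBr !mulKn // -addn_minl -minnMr exprD exprM -XYZ_classM.
have [ab|/ltnW ba] := leqP a b.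
  rewrite (eqP ab) expr0 mul1r exprMn mulrA; congr (_ * _).
  by rewrite mulrCA -exprD subnK.
rewrite (eqP ba) expr0 mulr1 exprMn !mulrA; congr (_ * _ * _).
by rewrite -exprD subnK.
Qed.

Lemma orbifold_ev_section (e : 'X_{1..2}) s t :
  (e 0%R = e 1%R %[mod n])%N ->
  orbifold_ev (s, t) (section_monomial e) = s ^+ e 0 * t ^+ e 1.
Proof.
move=> e01; rewrite /section_monomial !rmorphM !rmorphXn /=.
rewrite orbifold_evX orbifold_evY orbifold_evZ /=.
have [le01|/ltnW le10] := leqP (e 0) (e 1).
  have /dvdnP[k ek] : (n %| e 1%R - e 0%R)%N by rewrite -eqn_mod_dvd // e01.
  rewrite (eqP le01) div0n expr0 mul1r ek mulnK // -exprM mulnC -ek.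
  by rewrite exprMn mulrCA -exprD subnK.
have /dvdnP[k ek] : (n %| e 0%R - e 1%R)%N by rewrite -eqn_mod_dvd // e01.
rewrite (eqP le10) div0n expr0 mulr1 ek mulnK // -exprM mulnC -ek.
by rewrite exprMn mulrA -exprD subnK.
Qed.

(** Defined monomial by monomial, so linear but not multiplicative. *)
Definition orbifold_section : {mpoly K[2]} -> A := mpoly_lift section_monomial.
HB.instance Definition _ := GRing.Linear.on orbifold_section.

(** The comorphism of the quotient map (s, t) |-> (s^n, t^n, s t). *)
Definition orbifold_pullback : {mpoly K[3]} -> {mpoly K[2]} :=
  mpoly_mor (vec3 ('X_0 ^+ n) ('X_1 ^+ n) ('X_0 * 'X_1)).
HB.instance Definition _ := GRing.LRMorphism.on orbifold_pullback.

(** Since the section recovers the class of every monomial from its pullback, a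
   polynomial with zero pullback is a multiple of XY - Z^n. *)
Lemma orbifold_sectionK p : orbifold_section (orbifold_pullback p) = XYZ_class
  n p.
Proof.
move: p; apply: (mpoly_linear_ext (f := orbifold_section \o orbifold_pullback)
  (g := XYZ_class n)) => e /=.
rewrite XYZ_classE /orbifold_section /orbifold_pullback /mpoly_mor !mmapX
  /mmap1 !big_ord_recl !big_ord0 /vec3 /=.
rewrite !mulr1; set e0 := e ord0; set e1 := e _; set e2 := e _.
pose d := (U_(0%R) *+ (n * e0 + e2) + U_(1%R) *+ (n * e1 + e2))%MM : 'X_{1..2}.
transitivity (mpoly_lift section_monomial 'X_[d]).
  congr mpoly_lift; rewrite mpolyXD -!mpolyXn exprMn !exprD !exprM; ring.
rewrite mpoly_liftX (@section_monomialE e0 e1 e2) ?mulrA //.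
  by rewrite mnmDE !mulmnE !mnmE /= mul1n mul0n addn0.
by rewrite mnmDE !mulmnE !mnmE /= mul1n mul0n.
Qed.

Lemma orbifold_pullbackE v p :
  (orbifold_pullback p).@[v] = orbifold_ev (v 0, v 1) (XYZ_class n p).
Proof.
rewrite orbifold_evE; move: p.
pose f : {lrmorphism {mpoly K[3]} -> K^o} := meval v \o orbifold_pullback.
have fE : f =1 mpoly_mor (vec3 (v 0 ^+ n : K^o) (v 1 ^+ n) (v 0 * v 1));
  last exact: fE.
apply: mpoly_lrmorph_ext => i.
rewrite /f /=.
rewrite /orbifold_pullback !mpoly_morX.
case: i => -[|[|[|//]]] i3; rewrite /vec3 /=.
- by rewrite rmorphXn /= mevalXU.
- by rewrite rmorphXn /= mevalXU.
- by rewrite rmorphM /= !mevalXU.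
Qed.

Lemma XYZ_separating : separating (fun p => orbifold_ev p : {lrmorphism A ->
  K^o}).
Proof.
move=> a; rewrite -[a]reprK -[X in X = 0]/(XYZ_class n (repr a)) => ev0.
rewrite -orbifold_sectionK (_ : orbifold_pullback _ = 0) ?linear0 //.
apply: mpoly_separating => v; rewrite -[RHS](ev0 (v 0, v 1)).
exact: orbifold_pullbackE.
Qed.

Lemma prim_neq0 (zeta : K) : n.-primitive_root zeta -> zeta != 0.
Proof.
move=> prim; apply/eqP => z0; have := prim_expr_order prim.
by rewrite z0 expr0n gtn_eqF // => /esym/eqP; rewrite oner_eq0.
Qed.

(** The group acts on s^a t^b through zeta^(a - b), so only monomials with a and
   b congruent modulo n occur in an invariant, and these are pullbacks of the
   monomials chosen by [section_monomial]. *)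
Lemma cyclic_invariant zeta (q : {mpoly K[2]}) : n.-primitive_root zeta ->
  (forall s t, q.@[vec2 (zeta * s) (zeta^-1 * t)] = q.@[vec2 s t]) ->
  exists a : A, forall s t, q.@[vec2 s t] = orbifold_ev (s, t) a.
Proof.
move=> prim inv; have z0 := prim_neq0 prim.
have inv_e e : e \in msupp q -> (e 0%R = e 1%R %[mod n])%N.
  move=> eq; pose ch (e : 'X_{1..2}) := zeta ^+ e 0 * zeta ^- e 1.
  (* zeta acts on the monomial e through the scalar ch e *)
  pose tw (e : 'X_{1..2}) := ch e *: 'X_[e] : {mpoly K[2]}.
  have twE s t : (mpoly_lift tw q).@[vec2 s t] = q.@[vec2 (zeta * s) (zeta^-1
    * t)].
    pose g := meval (vec2 (zeta * s) (zeta^-1 * t)) : {lrmorphism {mpoly K[2]}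
      -> K^o}.
    pose f : {linear {mpoly K[2]} -> K^o} := meval (vec2 s t) \o mpoly_lift tw.
    suff fg : f =1 g by exact: fg.
    apply: mpoly_linear_ext => d; rewrite /f /g /=.
    rewrite mpoly_liftX /tw mevalZ !mevalX !big_ord_recl !big_ord0 /vec2 /=.
    rewrite !exprMn exprVn /ch !mulr1.
    rewrite (_ : lift ord0 ord0 = 1); last exact: val_inj.
    rewrite [ord0]/(0 : 'I_2); ring.
  have tq : mpoly_lift tw q = q.
    apply/eqP; rewrite -subr_eq0; apply/eqP/mpoly_separating => v.
    by rewrite raddfB /= !(meval_eq _ (vec2E v)) twE inv subrr.
  have : (mpoly_lift tw q)@_e = ch e * q@_e.
    rewrite /mpoly_lift raddf_sum /= (bigD1_seq e) //= big1 => [|d /negPf de].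
      by rewrite /tw !mcoeffZ mcoeffX eqxx mulr1 addr0 mulrC.
    by rewrite /tw !mcoeffZ mcoeffX de !mulr0.
  rewrite tq -{1}[q@_e]mul1r => /mulIf; rewrite -mcoeff_msupp => /(_ eq)/esym.
  move=> /(congr1 ( *%R^~ (zeta ^+ e 1)));
    rewrite /ch mul1r divfK ?expf_neq0 //.
  by move=> /eqP; rewrite (eq_prim_root_expr prim) => /eqP.
exists (orbifold_section q) => s t.
rewrite mevalE /orbifold_section /mpoly_lift linear_sum /= !big_seq.
apply: eq_bigr => e /inv_e eqe; rewrite linearZ /= orbifold_ev_section //.
by rewrite !big_ord_recl big_ord0 mulr1 (_ : lift ord0 ord0 = 1) //;
  exact: val_inj.
Qed.

End KleinianRing.

(** * Solving the Hessenberg equations *)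

Section Chart.
Variables (A : comNzRingType) (n : nat).
Hypothesis hn : (3 <= n)%N.
Implicit Types (x y : nat -> nat -> A) (X Y Z : A).

(** The entries of the second column from the diagonal on; families x of
   coordinates are meaningful only below the diagonal. *)
Definition col2 x (k : nat) : A := if (k == 2)%N then 1 else x k 2%N.

(** With m = n + 1 and Z = x21 this is Y; smaller m give the coefficient of - X
   in the solution for x_{m1}. *)
Definition col2_sum x Z (m : nat) : A :=
  \sum_(2 <= k < m) col2 x k * Z ^+ (m.-1 - k).

(** The coordinates of the point of the cell with given X, Y, Z, whose remaining
   coordinates are those of y; the first column and the corner entry x_{n2} are
   the dependent ones. *)
Definition chart X Y Z y (i j : nat) : A :=
  if (j == 1)%N then Z ^+ i.-1 - X * col2_sum y Z i
  else if (j == 2)%N && (i == n) then Y - Z * col2_sum y Z n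
  else y i j.

(** Row i of N c = x21 c - (x21^2 - x31) d, where N shifts c up by one and puts 0
   in row n; row 1 holds trivially. *)
Definition hess_rel x : Prop := forall i, (2 <= i <= n)%N ->
  (if i == n then 0 else x i.+1 1%N) =
  x 2%N 1%N * x i 1%N - (x 2%N 1%N ^+ 2 - x 3%N 1%N) * col2 x i.

Lemma col2_sum2 x Z : col2_sum x Z 2 = 0.
Proof. by rewrite /col2_sum big_geq. Qed.

Lemma col2_sumS x Z m : (2 <= m)%N ->
  col2_sum x Z m.+1 = Z * col2_sum x Z m + col2 x m.
Proof.
move=> m2; rewrite /col2_sum big_nat_recr //= subnn mulr1; congr (_ + _).
rewrite mulr_sumr; apply: eq_big_nat => k /andP[_ km].
by case: m m2 km => // m _ km; rewrite mulrCA -exprS subSn.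
Qed.

Lemma eq_col2_sum x y Z m :
  (forall k, (3 <= k < m)%N -> x k 2%N = y k 2%N) -> col2_sum x Z m = col2_sum
    y Z m.
Proof.
move=> xy; apply: eq_big_nat => k /andP[k2 km]; congr (_ * _).
rewrite /col2; case: eqP => // k2n; apply: xy.
by rewrite km andbT ltn_neqAle k2 andbT eq_sym; apply/eqP.
Qed.

Lemma chart21 X Y Z y : chart X Y Z y 2%N 1%N = Z.
Proof. by rewrite /chart /= col2_sum2 mulr0 subr0 expr1. Qed.

Lemma chart31 X Y Z y : chart X Y Z y 3%N 1%N = Z ^+ 2 - X.
Proof. by rewrite /chart /= col2_sumS // col2_sum2 mulr0 add0r mulr1. Qed.

Lemma chartn2 X Y Z y : chart X Y Z y n 2 = Y - Z * col2_sum y Z n.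
Proof. by rewrite /chart !eqxx. Qed.

Lemma chart_free X Y Z y i j : (j != 1)%N -> ~~ ((j == 2)%N && (i == n)) ->
  chart X Y Z y i j = y i j.
Proof. by rewrite /chart => /negPf -> /negPf ->. Qed.

Lemma chart_col2 X Y Z y i : (i < n)%N -> col2 (chart X Y Z y) i = col2 y i.
Proof. by move=> i_n; rewrite /col2 chart_free //= (ltn_eqF i_n). Qed.

Lemma chart_col2_sum X Y Z y : col2_sum (chart X Y Z y) Z n.+1 = Y.
Proof.
rewrite col2_sumS ?(ltnW hn) // (@eq_col2_sum _ y) => [|k /andP[_ kn]].
  by rewrite /col2 gtn_eqF // chartn2 addrC subrK.
by rewrite chart_free //= (ltn_eqF kn).
Qed.

(** Rows below n hold by the recursion for [col2_sum]; row n is X Y = Z^n. *)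
Lemma chart_hess_rel X Y Z y : X * Y = Z ^+ n -> hess_rel (chart X Y Z y).
Proof.
move=> XY i /andP[i2 i_n]; rewrite chart21 chart31 opprB addrCA subrr addr0.
have i0 : (0 < i)%N by apply: leq_trans i2.
rewrite [chart X Y Z y i 1%N]/(Z ^+ _ - _) mulrBr -exprS prednK // -addrA.
rewrite -opprD mulrCA -mulrDr; case: ifP => [/eqP ->|/negbT i_nn].
  have -> : Z * col2_sum y Z n + col2 (chart X Y Z y) n = Y.
    by rewrite /col2 gtn_eqF // chartn2 addrC subrK.
  by rewrite XY subrr.
by rewrite chart_col2 ?ltn_neqAle ?i_nn // -col2_sumS.
Qed.

Section Solve.
Variable x : nat -> nat -> A.
Hypothesis xrel : hess_rel x.
Let Z := x 2%N 1%N.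
Let X := Z ^+ 2 - x 3%N 1%N.
Let Y := col2_sum x Z n.+1.

Lemma hess_rel_col1 i : (2 <= i <= n)%N -> x i 1%N = Z ^+ i.-1 - X * col2_sum
  x Z i.
Proof.
case: i => [|[|i]] //= i_n; elim: i i_n => [|i IHi] i_n.
  by rewrite col2_sum2 mulr0 subr0.
have := xrel (ltnW i_n : (2 <= i.+2 <= n)%N); rewrite ltn_eqF // => ->.
rewrite (IHi (ltnW i_n)) (@col2_sumS _ _ i.+2) // -/Z -/X /= exprS.
by rewrite mulrBr mulrDr opprD addrA (mulrCA Z X) -!exprS.
Qed.

(** Row n of the relations, once the first column has been eliminated. *)
Lemma hess_rel_kleinian : X * Y = Z ^+ n.
Proof.
have n2 : (2 <= n)%N by apply: ltnW.
have := xrel (_ : (2 <= n <= n)%N); rewrite n2 leqnn eqxx => /(_ isT)/esym.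
rewrite (@hess_rel_col1 n) ?n2 ?leqnn // -/Z -/X /Y col2_sumS // => e.
have Zn : Z ^+ n = Z * Z ^+ n.-1 by rewrite -exprS prednK // ltnW.
apply/esym/eqP; rewrite -subr_eq0; apply/eqP; rewrite -[RHS]e Zn mulrBr mulrDr.
by rewrite opprD addrA (mulrCA Z X).
Qed.

Lemma hess_rel_chart i j : (1 <= j < i)%N -> (i <= n)%N -> x i j = chart X Y Z
  x i j.
Proof.
move=> /andP[j1 ji] i_n; rewrite /chart; case: eqP => [->|jn1].
  by apply: hess_rel_col1; rewrite i_n (leq_trans _ ji).
case: andP => // -[/eqP -> /eqP ->].
by rewrite /Y col2_sumS ?(ltnW hn) // /col2 gtn_eqF // addrAC subrr add0r.
Qed.

End Solve.
End Chart.

Lemma col2_sum_morph (A B : comNzRingType) (f : {rmorphism A -> B}) x Z m :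
  f (col2_sum x Z m) = col2_sum (fun i j => f (x i j)) (f Z) m.
Proof.
rewrite rmorph_sum; apply: eq_bigr => k _; rewrite rmorphM rmorphXn /col2.
by case: eqP => _; rewrite ?rmorph1.
Qed.

Lemma chart_morph (A B : comNzRingType) (f : {rmorphism A -> B}) n X Y Z y i j :
  f (chart n X Y Z y i j) = chart n (f X) (f Y) (f Z) (fun i j => f (y i j)) i
    j.
Proof.
rewrite /chart; case: ifP => _; last case: ifP => _ //.
  by rewrite rmorphB rmorphXn rmorphM col2_sum_morph.
by rewrite rmorphB rmorphM col2_sum_morph.
Qed.

Lemma eq_chart (A : comNzRingType) n (X Y Z : A) y y' i j :
  (forall i j, (1 <= j < i)%N -> (i <= n)%N -> (j != 1)%N ->
     ~~ ((j == 2)%N && (i == n)) -> y i j = y' i j) ->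
  (1 <= j < i)%N -> (i <= n)%N -> chart n X Y Z y i j = chart n X Y Z y' i j.
Proof.
move=> yy /[dup] ji /andP[j1 jlti] i_n; rewrite /chart.
have sumE m : (m <= n)%N -> col2_sum y Z m = col2_sum y' Z m.
  move=> mn; apply: eq_col2_sum => k /andP[k3 km]; have kn := leq_trans km mn.
  by apply: yy; rewrite ?k3 ?(ltnW kn) //= (ltn_eqF kn).
case: eqP => [_|/eqP jn1]; first by rewrite sumE.
by case: ifP => [_|/negbT]; [rewrite sumE | exact: yy].
Qed.

Lemma hess_rel_ext (A : comNzRingType) n (x x' : nat -> nat -> A) : (3 <= n)%N
  ->
  (forall i j, (1 <= j < i)%N -> (i <= n)%N -> x i j = x' i j) ->
  hess_rel n x -> hess_rel n x'.
Proof.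
move=> hn xx xrel i /[dup] i2n /andP[i2 i_n]; have n2 := ltnW hn.
have <- : col2 x i = col2 x' i.
  by rewrite /col2; case: eqP => // /eqP i2n';
    rewrite xx //= ltn_neqAle i2 andbT eq_sym.
rewrite -(xx 2 1) // -(xx 3 1) // -(xx i 1) // -xrel //;
  case: eqP => // /eqP inn.
by rewrite xx //= ?ltnS ?(ltnW i2) // ltn_neqAle inn.
Qed.

(** * Coordinate functions indexed by pairs *)

Section Coordinates.
Variables (K : fieldType) (n : nat) (P : rel nat).
Local Notation MP := {mpoly K[nvars n P]}.

Lemma xvar_rank (t : xidx n P) :
  xvar (val t).1 (val t).2 = 'X_(enum_rank t) :> MP.
Proof.
rewrite /xvar; case: pickP => [s /andP[/eqP e1 /eqP e2]|/(_ t)];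
  last by rewrite !eqxx.
congr 'X_(enum_rank _); apply/val_inj;
  move: (val s) (val t) e1 e2 => [? ?] [? ?] /=.
by move=> e1 e2; congr pair; apply: val_inj.
Qed.

Lemma xvarP (k : 'I_(nvars n P)) :
  exists i j, [/\ P i j, (i <= n)%N, (j <= n)%N & 'X_k = xvar i j :> MP].
Proof.
exists (val (enum_val k)).1, (val (enum_val k)).2.
by rewrite !leq_ord xvar_rank enum_valK; split=> //; exact: (valP (enum_val k)).
Qed.

Lemma mpoly_xvar_ext (B : comAlgType K) (f g : {lrmorphism MP -> B}) :
  (forall i j, P i j -> (i <= n)%N -> (j <= n)%N ->
     f (xvar i j) = g (xvar i j)) -> f =1 g.
Proof.
move=> fg; apply: mpoly_lrmorph_ext => k.
by have [i [j [ij i_n j_n ->]]] := xvarP k; exact: fg.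
Qed.

Lemma xvar_eq0 i j : ~~ P i j -> xvar i j = 0 :> MP.
Proof.
rewrite /xvar => nP; case: pickP => // t /andP[/eqP e1 /eqP e2].
by have := valP t; rewrite /= e1 e2 (negPf nP).
Qed.

Definition coords (T : Type) (f : nat -> nat -> T) (k : 'I_(nvars n P)) : T :=
  f (val (enum_val k)).1 (val (enum_val k)).2.

Lemma xvar_ind (T : Type) (f : nat -> nat -> T) (g : MP -> T) :
  (forall k, g 'X_k = coords f k) ->
  forall i j, P i j -> (i <= n)%N -> (j <= n)%N -> g (xvar i j) = f i j.
Proof.
move=> gX i j Pij i_n j_n.
have [i_n1 j_n1] : (i < n.+1)%N * (j < n.+1)%N by [].
pose t : xidx n P := exist _ (Ordinal i_n1, Ordinal j_n1) Pij.
rewrite -[xvar i j]/(xvar (val t).1 (val t).2) xvar_rank gX.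
by rewrite /coords enum_rankK.
Qed.

Lemma mpoly_mor_xvar (B : comAlgType K) (f : nat -> nat -> B) i j :
  P i j -> (i <= n)%N -> (j <= n)%N -> mpoly_mor (coords f) (xvar i j : MP) =
    f i j.
Proof. by apply: xvar_ind => k; rewrite mpoly_morX. Qed.

Lemma meval_xvar (f : nat -> nat -> K) i j :
  P i j -> (i <= n)%N -> (j <= n)%N -> (xvar i j : MP).@[coords f] = f i j.
Proof. by apply: xvar_ind => k; rewrite mevalXU. Qed.

End Coordinates.

(** * Flags in the opposite cell *)

Section FlagCell.
Variables (K : closedFieldType) (n : nat).
Implicit Types (g : 'M[K]_n) (u a : 'cV[K]_n).
Local Notation coordsV := ('I_(nvars n below_diag) -> K).

Lemma flag_of1P (j : 'I_n.+1) u :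
  reflect (forall k : 'I_n, (j <= k)%N -> u k 0 = 0) (u \in flag_of 1%:M j).
Proof.
rewrite ffunE; apply: (iffP idP) => [|u0].
  move=> /(@coord_span _ _ _ (in_tuple _)) -> k jk.
  rewrite summxE big1 // => i _; rewrite mxE.
  have i_s : (i < size [seq k : 'I_n <- enum 'I_n | (k < j)%N])%N.
    by rewrite -(size_map (fun k => col k (1%:M : 'M[K]_n))).
  rewrite (nth_map k) // !mxE.
  have := mem_nth k i_s; rewrite mem_filter => /andP[+ _].
  case: eqP => [<-|_ _]; last by rewrite mulr0.
  by rewrite ltnNge jk.
have -> : u = \sum_k u k 0 *: col k 1%:M.
  apply/colP => i; rewrite summxE (bigD1 i) //= big1 => [|k /negPf ki].
    by rewrite !mxE eqxx mulr1 addr0.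
  by rewrite !mxE eq_sym ki mulr0.
apply: memv_suml => k _; have [jk|kj] := leqP j k.
  by rewrite u0 // scale0r mem0v.
by apply/memvZ/memv_span/map_f; rewrite mem_filter kj mem_enum.
Qed.

Lemma flag_of_act g : flag_of g = mx_act g (flag_of 1%:M).
Proof.
apply/ffunP => j; rewrite !ffunE limg_span -map_comp; congr <<_>>%VS.
by apply: eq_map => k /=; rewrite lfunE /= !colE mul1mx.
Qed.

Lemma flag_ofP g (j : 'I_n.+1) u :
  (u \in flag_of g j) <->
  exists2 a : 'cV[K]_n, (forall k : 'I_n, (j <= k)%N -> a k 0 = 0) & u = g *m a.
Proof.
rewrite flag_of_act ffunE; split=> [/memv_imgP[a /flag_of1P a0 ->]|[a a0 ->]].
  by exists a => //; rewrite lfunE.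
rewrite -[g *m a](lfunE (mulmx g)); apply: memv_img; exact/flag_of1P.
Qed.

Lemma Fl_flag_of g : g \in unitmx -> Fl (flag_of g).
Proof.
move=> gu; have [dim1 mono1] := Fl_flag1 K n.
rewrite flag_of_act; split=> [i|i j ij]; last first.
  by rewrite ![mx_act _ _ _]ffunE; apply/limgS/mono1.
rewrite [mx_act _ _ _]ffunE limg_dim_eq ?dim1 //; apply/eqP; rewrite -subv0.
apply/subvP => u.
rewrite memv_cap memv_ker lfunE /= memv0 => /andP[_ /eqP gu0].
by rewrite -[u](mulKmx gu) gu0 mulmx0.
Qed.

Lemma col_flag_of g (j : 'I_n.+1) (k : 'I_n) :
  (k < j)%N -> col k g \in flag_of g j.
Proof.
move=> kj; rewrite ffunE; apply/memv_span/map_f.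
by rewrite mem_filter kj mem_enum.
Qed.

Section Unipotent.
Variable g : 'M[K]_n.
Hypothesis g_trig : forall i j : 'I_n, (i < j)%N -> g i j = 0.
Hypothesis g_diag : forall i, g i i = 1.

Lemma unip_unitmx : g \in unitmx.
Proof.
rewrite unitmxE det_trig; last exact/is_trig_mxP.
by rewrite big1 ?unitr1.
Qed.

(** Forward substitution: the coefficients of u on the columns of g vanish one
   after the other. *)
Lemma unip_flag_eq0 (j : 'I_n.+1) u : u \in flag_of g j ->
  (forall k : 'I_n, (k < j)%N -> u k 0 = 0) -> u = 0.
Proof.
move=> /flag_ofP[a a0 ->] u0; suff -> : a = 0 by rewrite mulmx0.
suff ak m (k : 'I_n) : (k <= m)%N -> a k 0 = 0.
  by apply/colP => k; rewrite (ak k) ?mxE.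
elim: m k => [|m IHm] k km; have [jk|kj] := leqP j k; try exact: a0.
all: move: (u0 k kj);
  rewrite mxE (bigD1 k) //= g_diag mul1r big1 ?addr0 // => l lk.
all: have [kl|{lk}lk|/val_inj kl] := ltngtP k l; try by rewrite g_trig ?mul0r.
all: try by rewrite kl eqxx in lk.
  by rewrite ltnNge (leq_trans km) in lk.
by rewrite IHm ?mulr0 // -ltnS (leq_trans lk).
Qed.

End Unipotent.

Lemma unipE v (i j : 'I_n) :
  unip v i j = if i == j then 1 else
    (xvar i.+1 j.+1 : {mpoly K[nvars n below_diag]}).@[v].
Proof. by rewrite !mxE; case: eqP => // _; rewrite meval1. Qed.

Lemma unip_trig v (i j : 'I_n) : (i < j)%N -> unip (v : coordsV) i j = 0.
Proof.
move=> ij; rewrite unipE -val_eqE (ltn_eqF ij) xvar_eq0 ?meval0 //.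
by rewrite /below_diag /= ltnS -leqNgt ltnW.
Qed.

Lemma unip_diag v (i : 'I_n) : unip (v : coordsV) i i = 1.
Proof. by rewrite unipE eqxx. Qed.

(** Column j of a unipotent matrix is determined by the flag: the difference of
   two candidates lies in V_{j+1} and vanishes in the rows up to j. *)
Lemma flag_unip_inj (v v' : coordsV) :
  flag_of (unip v) = flag_of (unip v') -> v =1 v'.
Proof.
move=> vv'; suff e : unip v = unip v'.
  move=> k; rewrite -(mevalXU v k) -(mevalXU v' k).
  have [[|i] [[|j] [/andP[//= _ ji] // i_n _ ->]]] := xvarP K k.
  have /matrixP/(_ (Ordinal i_n) (Ordinal (ltnW (leq_trans ji i_n)))) := e.
  by rewrite !unipE -val_eqE /= gtn_eqF.
apply/matrixP => i j; apply/eqP; rewrite -subr_eq0; apply/eqP.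
suff /colP/(_ i) : col j (unip v) - col j (unip v') = 0 by rewrite !mxE.
have jn : (j.+1 < n.+1)%N by rewrite ltnS.
apply: (@unip_flag_eq0 (unip v') _ _ (Ordinal jn)).
- exact: unip_trig.
- exact: unip_diag.
- by apply: memvB; [rewrite -vv' |]; exact: col_flag_of.
move=> k; rewrite ltnS leq_eqVlt => /orP[/eqP/val_inj ->|kj].
  by rewrite !mxE eqxx !meval1 subrr.
have := unip_trig v kj; have := unip_trig v' kj; rewrite !mxE => -> ->.
by rewrite subrr.
Qed.

(** Dividing each column of a lower triangular matrix by its diagonal entry makes
   the matrix unipotent and preserves the flag. *)
Lemma opp_cell_unip V : opp_cell V -> exists v : coordsV, V = flag_of (unip v).
Proof.
move=> [b [/is_trig_mxP b_trig bu ->]]; rewrite -flag_of_act.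
have b0 j : b j j != 0.
  move: bu; rewrite unitmxE det_trig; last exact/is_trig_mxP.
  by rewrite unitfE => /prodf_neq0; apply.
pose x i j : K := match insub i.-1, insub j.-1 with
  | Some i, Some j => b i j / b j j | _, _ => 0 end.
exists (coords x).
have colE j : col j (unip (coords x)) = (b j j)^-1 *: col j b.
  apply/colP => i; rewrite !mxE; case: eqP => [->|/eqP ij].
    by rewrite meval1 mulVf.
  have [lt_ij|lt_ji|/val_inj/eqP] := ltngtP i j; last by rewrite (negPf ij).
    rewrite (b_trig i j) // mulr0 xvar_eq0 ?meval0 //.
    by rewrite /below_diag /= ltnS -leqNgt ltnW.
  rewrite meval_xvar ?(ltn_ord i) ?(ltn_ord j) // /x /=.
  by rewrite !valK mulrC.
apply/ffunP => j; rewrite !ffunE; apply/eqP; rewrite eqEsubv.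
apply/andP; split; apply/span_subvP => _ /mapP[k kj ->].
  rewrite -[col k b](scalerKV (b0 k)) -colE.
  by apply/memvZ/memv_span/map_f.
by rewrite colE; apply/memvZ/memv_span/map_f.
Qed.

Lemma opp_cell_flag_unip (v : coordsV) : opp_cell (flag_of (unip v)).
Proof.
exists (unip v); split; last exact: flag_of_act.
  by apply/is_trig_mxP => i j; exact: unip_trig.
by apply: unip_unitmx; [exact: unip_trig | exact: unip_diag].
Qed.

End FlagCell.

(** * Points of the Hessenberg variety in the cell *)

Section HessCell.
Variables (K : closedFieldType) (n : nat) (hn : (3 <= n)%N).
Local Notation coordsV := ('I_(nvars n below_diag) -> K).

Definition xval (v : coordsV) (i j : nat) : K := (xvar i j).@[v].

(** As h_2(i) = n for i >= 2, only the condition on V_1 is nontrivial. *)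
Lemma hess_cell_span (v : coordsV) :
  hess_cell (h2 hn) (flag_of (unip v)) <->
  Defs.nilp K n *m col (Ordinal (ltnW (ltnW hn))) (unip v) \in flag_of (unip
    v) (inord 2).
Proof.
have gu : unip v \in unitmx.
  by apply: unip_unitmx; [exact: unip_trig | exact: unip_diag].
set i0 := Ordinal _; set g := unip v in gu *.
split=> [[[_ +] _]|Nc].
  have n1 : (1 < n.+1)%N := ltnW (ltnW hn).
  move=> /(_ (inord 1)); rewrite inordK // => /(_ isT).
  move=> /subvP; apply; rewrite -[X in X \in _](lfunE (mulmx (Defs.nilp K n))).
  by apply/memv_img/col_flag_of; rewrite inordK.
split; last exact: opp_cell_flag_unip.
split=> [|i i1]; first exact: Fl_flag_of.
apply/subvP => _ /memv_imgP[u /flag_ofP[a a0 ->] ->]; rewrite lfunE /= /h2_fun.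
case: eqP => [i_1|_].
  rewrite (_ : g *m a = a i0 0 *: col i0 g) -?scalemxAr; first exact: memvZ.
  apply/colP => k; rewrite mxE [RHS]mxE [col _ _ _ _]mxE (bigD1 i0) //= big1
    ?addr0 => [|l l0].
    by rewrite [RHS]mulrC.
  by rewrite a0 ?mulr0 // i_1 lt0n.
apply/flag_ofP; exists (invmx g *m (Defs.nilp K n *m (g *m a))).
  by move=> k; rewrite inordK // leqNgt ltn_ord.
by rewrite mulKVmx.
Qed.

Lemma unip_xval (v : coordsV) (i j : 'I_n) : (j < i)%N ->
  unip v i j = xval v i.+1 j.+1.
Proof. by move=> ji; rewrite unipE -val_eqE gtn_eqF. Qed.

(** Rows 1 and 2 of N c = a c + b d determine a and b; the others are the
   relations. *)
Lemma hess_cellP (v : coordsV) :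
  hess_cell (h2 hn) (flag_of (unip v)) <-> hess_rel n (xval v).
Proof.

pose i0 : 'I_n := Ordinal (ltnW (ltnW hn)); pose i1 : 'I_n := Ordinal (ltnW hn).

have comb (a : 'cV[K]_n) i : (forall k : 'I_n, (2 <= k)%N -> a k 0 = 0) ->
    (unip v *m a) i 0 = unip v i i0 * a i0 0 + unip v i i1 * a i1 0.
  move=> a0; rewrite mxE (bigD1 i0) //= (bigD1 i1) //= big1 ?addr0 // => k.
  move=> /andP[k0 k1]; rewrite a0 ?mulr0 //.
  by move: k0 k1; rewrite -!val_eqE /=; case: (val k) => [|[|]].
have shift (i : 'I_n) :
    (Defs.nilp K n *m col i0 (unip v)) i 0 = if i.+1 == n then 0 else xval v
      i.+2 1.
  rewrite mxE; case: eqP => [i_n|/eqP i_n].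
    rewrite big1 // => k _; rewrite !mxE [i.+1 == _]gtn_eqF ?mul0r // i_n.
    exact: ltn_ord.
  have iS : (i.+1 < n)%N by rewrite ltn_neqAle i_n ltn_ord.
  rewrite (bigD1 (Ordinal iS)) //= big1 => [|k].
    by rewrite addr0 mxE eqxx mul1r mxE unip_xval.
  by rewrite -val_eqE eq_sym !mxE /= => /negPf ->; rewrite mul0r.
have col1 (i : 'I_n) : (1 <= i)%N -> unip v i i0 = xval v i.+1 1.
  by move=> i_1; rewrite unip_xval.
have col2E (i : 'I_n) : (1 <= i)%N -> unip v i i1 = col2 (xval v) i.+1.
  rewrite /col2 leq_eqVlt => /orP[/eqP i_1|i_1];
    last by rewrite unip_xval // gtn_eqF.
  by rewrite -i_1 (_ : i = i1) ?unip_diag //; apply: val_inj.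
apply: (iff_trans (hess_cell_span v)); split.
  move=> /flag_ofP[a]; rewrite inordK ?ltnS ?(ltnW hn) // => a0 /colP Na.
  have {Na}eqs i := etrans (esym (shift i)) (etrans (Na i) (comb a i a0)).
  have a0E : a i0 0 = xval v 2 1.
    have := eqs i0; rewrite unip_diag unip_trig // mul1r mul0r addr0 /= => <-.
    by rewrite (ltn_eqF (ltnW hn)).
  have a1E : a i1 0 = xval v 3 1 - xval v 2 1 ^+ 2.
    have := eqs i1; rewrite unip_diag mul1r a0E col1 //= (ltn_eqF hn) => ->.
    by rewrite expr2 addrAC subrr add0r.
  case=> // i /andP[i_2 i_n]; have := eqs (Ordinal i_n); rewrite /= => ->.
  rewrite a0E a1E col1 // col2E // -(opprB (xval v 2 1 ^+ 2)) mulrN.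
  by congr (_ - _); exact: mulrC.
move=> rel; apply/flag_ofP.
exists (\col_k (if k == i0 then xval v 2 1 else
   if k == i1 then xval v 3 1 - xval v 2 1 ^+ 2 else 0)).
  move=> k; rewrite inordK ?ltnS ?(ltnW hn) // mxE -!val_eqE /= => k2.
  by rewrite !gtn_eqF // ltnW.
apply/colP => i; rewrite shift comb => [|k k2]; last first.
  by rewrite mxE -!val_eqE /= !gtn_eqF // ltnW.
rewrite [(\col_k _) i0 0]mxE [(\col_k _) i1 0]mxE !eqxx -[i1 == i0]val_eqE /=.
have [i_0|i_pos] := posnP i.
  have -> : i = i0 by apply: val_inj.
  by rewrite (ltn_eqF (ltnW hn)) unip_diag unip_trig // mul1r mul0r addr0.
rewrite rel ?ltn_ord ?ltnS ?i_pos // col1 // col2E //.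
rewrite -(opprB (xval v 2 1 ^+ 2)) mulrN.
by congr (_ - _); exact: mulrC.
Qed.

End HessCell.

(** * The isomorphism of coordinate rings *)

Section HessRing.
Variables (K : closedFieldType) (n : nat) (hn : (3 <= n)%N).
Local Notation MP := {mpoly K[nvars n below_diag]}.
Local Notation h := (h2 hn).
Local Notation H := (hess_ring K h).
Local Notation x := (hess_x K h).
Local Notation I := (hess_ideal h : idealr MP).

Lemma hess_idealP (p : MP) :
  reflect (forall v, hess_rel n (xval v) -> p.@[v] = 0) (p \in I).
Proof.
apply: (iffP idP) => [/asboolP p0 v /(hess_cellP hn)|p0]; first exact: p0.
by apply/asboolP => v /(hess_cellP hn); exact: p0.
Qed.

Definition hess_pi : MP -> H := quot_pi I.
HB.instance Definition _ := GRing.LRMorphism.on hess_pi.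

Lemma hess_x_rel : hess_rel n x.
Proof.
move=> i i_n; apply/eqP.
pose y i j : MP := xvar i j.
have col2E : col2 x i = hess_pi (col2 y i).
  by rewrite /col2; case: eqP; rewrite ?rmorph1.
have -> : (if i == n then 0 else x i.+1 1) = hess_pi (if i == n then 0 else y
  i.+1 1%N).
  by case: ifP; rewrite ?rmorph0.
rewrite col2E -[x 2 1]/(hess_pi (y 2%N 1%N)) -[x 3 1]/(hess_pi (y 3%N 1%N)).
rewrite -[x i 1]/(hess_pi (y i 1%N)) -!rmorphM -rmorphXn -rmorphB -rmorphM
  -rmorphB.
rewrite -Quotient.idealrBE; apply/hess_idealP => v /(_ i i_n) rel.
have col2v : (col2 y i).@[v] = col2 (xval v) i.
  by rewrite /col2; case: eqP; rewrite ?meval1.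
rewrite !(mevalB, mevalM) /= col2v -[(y i 1%N).@[v]]/(xval v i 1).
rewrite -[(y 2%N 1%N).@[v]]/(xval v 2 1) -[(y 3%N 1%N).@[v]]/(xval v 3 1)
  -expr2 -rel.
by case: ifP => _; rewrite ?meval0 subrr.
Qed.

Section Point.
Variable v : 'I_(nvars n below_diag) -> K.
Hypothesis v_rel : hess_rel n (xval v).

Lemma hess_ev_killed (p : MP) : p \in I -> (meval v p : K^o) = 0.
Proof. by move/hess_idealP; exact. Qed.

Definition hess_ev : H -> K^o :=
  quot_mor (f := meval v : {lrmorphism MP -> K^o}) hess_ev_killed.
HB.instance Definition _ := GRing.LRMorphism.on hess_ev.

Lemma hess_evE p : hess_ev (hess_pi p) = p.@[v].
Proof. exact: (quot_mor_pi (f := meval v : {lrmorphism MP -> K^o})). Qed.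

End Point.

Lemma xval_coords (f : nat -> nat -> K) i j : (1 <= j < i)%N -> (i <= n)%N ->
  xval (coords f : 'I_(nvars n below_diag) -> K) i j = f i j.
Proof.
move=> ji i_n; rewrite /xval meval_xvar //.
by case/andP: ji => _ /ltnW/leq_trans; apply.
Qed.

Lemma chart_rel (X Y Z : K) y : X * Y = Z ^+ n ->
  hess_rel n (xval (coords (chart n X Y Z y) : 'I_(nvars n below_diag) -> K)).
Proof.
move=> /(chart_hess_rel hn y); apply: hess_rel_ext => // i j ji i_n.
by rewrite xval_coords.
Qed.

Local Notation A := (XYZ_ring K n).
Local Notation B := {mpoly K[nvars n (col2_vars n)]}.
Local Notation D := {mpoly K[nvars n right_vars]}.
Local Notation T := (tensor (tensor A B) D).
Local Notation Z := (x 2 1).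
Local Notation X := (Z ^+ 2 - x 3 1).
Local Notation Y := (col2_sum x Z n.+1).

Definition phi_XYZ : A -> H := XYZ_mor (hess_rel_kleinian hn hess_x_rel).
HB.instance Definition _ := GRing.LRMorphism.on phi_XYZ.
Definition phi_col2 : B -> H := mpoly_mor (coords x).
HB.instance Definition _ := GRing.LRMorphism.on phi_col2.
Definition phi_right : D -> H := mpoly_mor (coords x).
HB.instance Definition _ := GRing.LRMorphism.on phi_right.
Definition hess_phi : T -> H := tens_mor (tens_mor phi_XYZ phi_col2) phi_right.
HB.instance Definition _ := GRing.LRMorphism.on hess_phi.

Lemma hess_phiE a b d :
  hess_phi (tens (tens a b) d) = phi_XYZ a * phi_col2 b * phi_right d.
Proof. by rewrite /hess_phi tens_morE /= tens_morE. Qed.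

Lemma hess_phi_XYZ a : hess_phi (tens (tens a 1) 1) = phi_XYZ a.
Proof. by rewrite hess_phiE !rmorph1 !mulr1. Qed.

Lemma phi_X : phi_XYZ (XYZ_class n 'X_0) = X.
Proof. by rewrite /phi_XYZ XYZ_morE mpoly_morX. Qed.
Lemma phi_Y : phi_XYZ (XYZ_class n 'X_1) = Y.
Proof. by rewrite /phi_XYZ XYZ_morE mpoly_morX. Qed.
Lemma phi_Z : phi_XYZ (XYZ_class n 'X_2) = Z.
Proof. by rewrite /phi_XYZ XYZ_morE mpoly_morX. Qed.

Lemma hess_phi_col2 i : (3 <= i <= n - 1)%N ->
  hess_phi (tens (tens 1 (xvar i 2)) 1) = x i 2.
Proof.
move=> i_n; rewrite hess_phiE !rmorph1 mul1r mulr1 /phi_col2 mpoly_mor_xvar //.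
- by rewrite /col2_vars i_n.
- by case/andP: i_n => _ /leq_trans; apply; exact: leq_subr.
- exact: ltnW hn.
Qed.

Lemma hess_phi_right i j : (3 <= j < i)%N -> (i <= n)%N ->
  hess_phi (tens 1 (xvar i j)) = x i j.
Proof.
move=> ji i_n; rewrite -tens1 hess_phiE !rmorph1 !mul1r /phi_right
  mpoly_mor_xvar //.
by case/andP: ji => _ /ltnW/leq_trans; apply.
Qed.

Definition free_coord (i j : nat) : T :=
  if (j == 2)%N then tens (tens 1 (xvar i j)) 1 else tens 1 (xvar i j).

Definition hess_psi : MP -> T := mpoly_mor (coords (chart n
  (tens (tens (XYZ_class n 'X_0) 1) 1) (tens (tens (XYZ_class n 'X_1) 1) 1)
  (tens (tens (XYZ_class n 'X_2) 1) 1) free_coord)).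
HB.instance Definition _ := GRing.LRMorphism.on hess_psi.

(** Both sides are algebra morphisms, and on coordinates the equation says that
   the coordinates of the Hessenberg ring satisfy [hess_rel_chart]. *)
Lemma hess_psiK p : hess_phi (hess_psi p) = hess_pi p.
Proof.
pose f : {lrmorphism MP -> H} := hess_phi \o hess_psi.
suff e : f =1 hess_pi by exact: e.
apply: mpoly_xvar_ext => i j ji i_n j_n.
rewrite /f /= /hess_psi mpoly_mor_xvar //
  chart_morph /= !hess_phi_XYZ phi_X phi_Y phi_Z.
rewrite -[RHS]/(x i j) [RHS](hess_rel_chart hn hess_x_rel ji) //.
apply: eq_chart => // {}i {}j {i_n j_n ji} /andP[j1 ji] i_n jn1 nin.
rewrite /free_coord; case: eqP => [j2|/eqP j2].
  move: ji nin; rewrite j2 /= => i3 nin; rewrite hess_phi_col2 // i3 /=.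
  have n0 : (0 < n)%N := ltnW (ltnW hn).
  by rewrite -ltnS subn1 prednK // ltn_neqAle nin.
by rewrite hess_phi_right // ji andbT; case: j j1 jn1 j2 {ji nin} => [|[|[|]]].
Qed.

(** Evaluating the image at the point of the cell with parameters
   (s^n, t^n, s t, u, w) evaluates the tensor at ((s, t), u, w); these
   evaluations separate the elements of the tensor product. *)
Lemma hess_phi_inj : injective hess_phi.
Proof.
suff ker0 a : hess_phi a = 0 -> a = 0.
  by move=> a b ab; apply/eqP; rewrite -subr_eq0; apply/eqP/ker0;
    rewrite linearB /= ab subrr.
have n0 : (0 < n)%N := ltnW (ltnW hn).
move=> a0; apply: (tens_separating (tens_separating (XYZ_separating n0)
  (@mpoly_separating K _)) (@mpoly_separating K _)) => -[[[s t] u] w] /=.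
pose y (i j : nat) := if (j == 2)%N then (xvar i j : B).@[u] else (xvar i j :
  D).@[w].
have rel := chart_rel y (esym (exprMn n s t)).
pose f : {lrmorphism T -> K^o} := hess_ev rel \o hess_phi.
have evx i j : (1 <= j < i)%N -> (i <= n)%N ->
    hess_ev rel (x i j) = chart n (s ^+ n) (t ^+ n) (s * t) y i j.
  by move=> ji i_n; rewrite -(xval_coords _ ji i_n) hess_evE.
have Zv : hess_ev rel Z = s * t by rewrite evx ?(ltnW hn) // chart21.
have Xv : hess_ev rel X = s ^+ n.
  by rewrite rmorphB rmorphXn /= Zv evx // chart31 opprB addrCA subrr addr0.
have Yv : hess_ev rel Y = t ^+ n.
  rewrite col2_sum_morph /= Zv -[RHS](chart_col2_sum hn (s ^+ n) _ (s * t) y).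
  by apply: eq_col2_sum => k /andP[k3 kn]; rewrite evx //= ltnW.
transitivity (f a); last by rewrite /f /= a0 linear0.
have evl ab : f (tens ab 1) = tens_mor (orbifold_ev (s, t))
    (meval u : {lrmorphism B -> K^o}) ab.
  pose f1 : {lrmorphism tensor A B -> K^o} := f \o @tens_inl _ (tensor A B) D.
  suff e : f1 =1 tens_mor (orbifold_ev (s, t)) (meval u : {lrmorphism B ->
    K^o}) by exact: e.
  apply: tens_lrmorph_ext => [c|b]; rewrite /f1 /f /= /tens_inl.
    rewrite hess_phi_XYZ /= tens_morE rmorph1 mulr1.
    pose f2 : {lrmorphism A -> K^o} := hess_ev rel \o phi_XYZ.
    suff e : f2 =1 orbifold_ev (s, t) by exact: e.
    apply: XYZ_lrmorph_ext; rewrite /f2 /=.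
    - by rewrite phi_X Xv orbifold_evX.
    - by rewrite phi_Y Yv orbifold_evY.
    - by rewrite phi_Z Zv orbifold_evZ.
  rewrite hess_phiE /= tens_morE !rmorph1 mulr1 !mul1r.
  pose f2 : {lrmorphism B -> K^o} := hess_ev rel \o phi_col2.
  suff e : f2 =1 (meval u : {lrmorphism B -> K^o}) by exact: e.
  apply: mpoly_xvar_ext => i j ij i_n j_n.
  rewrite /f2 /= /phi_col2 mpoly_mor_xvar //;
    move/andP: ij => [/andP[i3 i_n1] /eqP ->].
  rewrite evx ?(ltnW i3) // chart_free //=.
  by rewrite ltn_eqF // (leq_ltn_trans i_n1) // subn1 prednK.
apply: tens_lrmorph_ext => [ab|d].
  by rewrite evl /= tens_morE rmorph1 mulr1.
rewrite /f /= tens_morE rmorph1 mul1r -tens1 hess_phiE !rmorph1 !mul1r.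
pose f2 : {lrmorphism D -> K^o} := hess_ev rel \o phi_right.
suff e : f2 =1 (meval w : {lrmorphism D -> K^o}) by exact/esym/e.
apply: mpoly_xvar_ext => i j ij i_n j_n.
rewrite /f2 /= /phi_right mpoly_mor_xvar //; move/andP: ij => [j3 ji].
have j1 : (1 <= j)%N by apply: leq_trans j3.
rewrite evx ?j1 // chart_free ?(gtn_eqF (ltnW j3)) ?(gtn_eqF j3) //.
by rewrite /y (gtn_eqF j3).
Qed.

Lemma hess_phi_bij : bijective hess_phi.
Proof.
exists (fun q => hess_psi (repr q)) => [a|q].
  by apply: hess_phi_inj; rewrite hess_psiK /hess_pi /quot_pi reprK.
by rewrite hess_psiK /hess_pi /quot_pi reprK.
Qed.

End HessRing.

(** * The isomorphism of varieties *)

(** The coordinates that [chart] leaves free. *)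
Definition free_vars (n : nat) : rel nat :=
  fun i j => ((2 <= j < i) && ~~ ((j == 2) && (i == n)))%N.

(** The pairs 2 <= j < i <= n number C(n-1, 2), and (n, 2) is left out. *)
Lemma card_free_vars n : (3 <= n)%N ->
  nvars n (free_vars n) = (((n - 1) * (n - 2)) %/ 2 - 1)%N.
Proof.
move=> hn; rewrite /nvars card_sig.
pose T := [pred p : 'I_n.+1 * 'I_n.+1 | (2 <= p.2 < p.1)%N].
have h2 : (2 < n.+1)%N by apply: leqW.
pose p0 : 'I_n.+1 * 'I_n.+1 := (ord_max, Ordinal h2).
have -> : (((n - 1) * (n - 2)) %/ 2)%N = #|T|.
  rewrite -sum1_card -(pair_big_dep predT (fun i j : 'I_n.+1 => (2 <= j <
    i)%N) (fun _ _ => 1%N)) /=.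
  rewrite (eq_bigr (fun i : 'I_n.+1 => (i - 2)%N)) => [|i _].
    rewrite -(big_mkord predT (fun i => (i - 2)%N));
      case: (n) hn => [|[|m]] // _.
    rewrite big_nat_recl // big_nat_recl //= !add0n subn1 subn2 /=.
    rewrite (eq_bigr (fun k => k)) => [|k _]; last by rewrite subn2.
    by rewrite bin2_sum bin2 divn2.
  rewrite -(big_mkord (fun j => 2 <= j < i)%N (fun=> 1%N)).
  have i_n : (i <= n.+1)%N by apply: ltnW.
  rewrite -[RHS]muln1 -sum_nat_const_nat (big_nat_widen _ _ _ _ _ i_n).
  rewrite [RHS](big_nat_widenl _ 0) //.
  by apply: eq_bigl => j; rewrite andbC.
rewrite (cardD1 p0 T) !inE /= hn add1n subn1 /=.
apply: eq_card => -[i j]; rewrite !inE /free_vars xpair_eqE -!val_eqE /= andbC.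
by congr (_ && _); rewrite andbC.
Qed.

Section OrbifoldProduct.
Variables (K : closedFieldType) (n : nat) (hn : (3 <= n)%N) (zeta : K).
Hypothesis prim : n.-primitive_root zeta.
Local Notation h := (h2 hn).
Local Notation orb := (cyclic_orbit zeta).
Local Notation W := ('rV[K]_(nvars n (free_vars n))).
Let n0 : (0 < n)%N := ltnW (ltnW hn).

Let expn_eq0 (c : K) : (c ^+ n == 0) = (c == 0).
Proof. by rewrite expf_eq0 n0. Qed.

(** The three invariants separate the orbits. If p 0 0 <> 0, the ratio of the
   first coordinates is a power of zeta, and the product fixes the second one;
   otherwise the ratio of the second coordinates is used. *)
Lemma cyclic_orbitE (p q : 'rV[K]_2) : orb p q <->
  [/\ q 0 0 ^+ n = p 0 0 ^+ n, q 0 1 ^+ n = p 0 1 ^+ n & q 0 0 * q 0 1 = p 0 0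
    * p 0 1].
Proof.
have z0 := prim_neq0 n0 prim.
have zn k : (zeta ^+ k) ^+ n = 1 by rewrite exprAC (prim_expr_order prim)
  expr1n.
split=> [[k ->]|[e0 e1 e01]].
  rewrite !mxE /=; split.
  - by rewrite exprMn zn mul1r.
  - by rewrite exprMn exprVn zn invr1 mul1r.
  - by rewrite mulrACA divff ?mul1r // expf_neq0.
suff [k [k0 k1]] : exists k, q 0 0 = zeta ^+ k * p 0 0 /\ q 0 1 = zeta ^- k *
  p 0 1.
  exists k; apply/rowP => -[[|[|//]] i2]; rewrite mxE /=.
    by rewrite (_ : Ordinal i2 = 0) //; apply: val_inj.
  by rewrite (_ : Ordinal i2 = 1) //; apply: val_inj.
have [p00|p00] := eqVneq (p 0 0) 0.
  have q00 : q 0 0 = 0.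
    by apply/eqP; rewrite -expn_eq0 e0 p00 expr0n gtn_eqF.
  have [p01|p01] := eqVneq (p 0 1) 0.
    exists 0%N; rewrite p00 q00 p01 !mulr0; split=> //.
    by apply/eqP; rewrite -expn_eq0 e1 p01 expr0n gtn_eqF.
  have q01 : q 0 1 != 0 by rewrite -expn_eq0 e1 expn_eq0.
  have : (p 0 1 / q 0 1) ^+ n = 1 by rewrite expr_div_n e1 divff // expf_neq0.
  move=> /(prim_rootP prim)[k ek]; exists k; rewrite -ek p00 q00 mulr0;
    split=> //.
  by rewrite invf_div divfK.
have : (q 0 0 / p 0 0) ^+ n = 1 by rewrite expr_div_n e0 divff // expf_neq0.
move=> /(prim_rootP prim)[k ek]; exists k; rewrite -ek divfK //; split=> //.
have q00 : q 0 0 != 0 by rewrite -expn_eq0 e0 expn_eq0.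
by apply: (mulfI q00); rewrite e01 invf_div mulrA mulrCA divff // mulr1.
Qed.

Lemma orbit_of_eq (p q : 'rV[K]_2) :
  p 0 0 ^+ n = q 0 0 ^+ n -> p 0 1 ^+ n = q 0 1 ^+ n ->
  p 0 0 * p 0 1 = q 0 0 * q 0 1 -> orbit_of orb p = orbit_of orb q.
Proof.
move=> e0 e1 e01; rewrite /orbit_of; apply: eq_exist; apply/seteqP;
  split=> r /cyclic_orbitE[r0 r1 r01];
  by apply/cyclic_orbitE; rewrite r0 r1 r01 e0 e1 e01.
Qed.

Definition orbit_rep (O : orbits orb) : 'rV[K]_2 := projT1 (cid (svalP O)).

Lemma orbit_repK O : orbit_of orb (orbit_rep O) = O.
Proof.
rewrite /orbit_of /orbit_rep; case: O => O exO /=; apply: eq_exist.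
by case: cid => p /= <-.
Qed.

Lemma orbit_rep_of p : let q := orbit_rep (orbit_of orb p) in
  [/\ q 0 0 ^+ n = p 0 0 ^+ n, q 0 1 ^+ n = p 0 1 ^+ n & q 0 0 * q 0 1 = p 0 0
    * p 0 1].
Proof.
move=> q; apply/cyclic_orbitE.
have /(congr1 sval) /= <- := orbit_repK (orbit_of orb p).
by apply/cyclic_orbitE.
Qed.

Lemma orbifold_ev_rep (p : 'rV[K]_2) (a : XYZ_ring K n) : let q := orbit_rep
  (orbit_of orb p) in
  orbifold_ev (q 0 0, q 0 1) a = orbifold_ev (p 0 0, p 0 1) a :> K.
Proof.
move=> q; have [e0 e1 e01] := orbit_rep_of p.
rewrite -[a]reprK -[\pi_(_) (repr a)]/(XYZ_class n (repr a)) !orbifold_evE /=.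
by rewrite /q e0 e1 e01.
Qed.

Definition free_val (w : W) (i j : nat) : K :=
  (xvar i j : {mpoly K[nvars n (free_vars n)]}).@[w 0].

Definition chart_pt (p : 'rV[K]_2) (w : W) : 'I_(nvars n below_diag) -> K :=
  coords (chart n (p 0 0 ^+ n) (p 0 1 ^+ n) (p 0 0 * p 0 1) (free_val w)).

Lemma chart_pt_cell p w : hess_cell h (flag_of (unip (chart_pt p w))).
Proof. by apply/hess_cellP/(chart_rel hn)/esym/exprMn. Qed.

Lemma chart_pt_xval p w i j : (1 <= j < i)%N -> (i <= n)%N ->
  xval (chart_pt p w) i j = 
  chart n (p 0 0 ^+ n) (p 0 1 ^+ n) (p 0 0 * p 0 1) (free_val w) i j.
Proof. exact: xval_coords. Qed.

Lemma chart_pt_Z p w : xval (chart_pt p w) 2 1 = p 0 0 * p 0 1.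
Proof. by rewrite chart_pt_xval ?(ltnW hn) // chart21. Qed.

Lemma chart_pt_X p w :
  xval (chart_pt p w) 2 1 ^+ 2 - xval (chart_pt p w) 3 1 = p 0 0 ^+ n.
Proof. by rewrite chart_pt_Z chart_pt_xval //
  chart31 opprB addrCA subrr addr0. Qed.

Lemma chart_pt_Y p w :
  col2_sum (xval (chart_pt p w)) (xval (chart_pt p w) 2 1) n.+1 = p 0 1 ^+ n.
Proof.
rewrite chart_pt_Z -[RHS](chart_col2_sum hn (p 0 0 ^+ n) _ (p 0 0 * p 0 1)
  (free_val w)).
by apply: eq_col2_sum => k /andP[k3 kn]; rewrite chart_pt_xval //= ltnW.
Qed.

Lemma chart_pt_free p w i j : free_vars n i j -> (i <= n)%N ->
  xval (chart_pt p w) i j = free_val w i j.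
Proof.
move=> /andP[/andP[j2 ji] nin] i_n.
by rewrite chart_pt_xval ?(ltnW j2) // chart_free // gtn_eqF.
Qed.

Definition cell_pt (p : 'rV[K]_2) (w : W) : hess_variety K h :=
  exist _ _ (chart_pt_cell p w).

Lemma eq_chart_pt (p q : 'rV[K]_2) w : p 0 0 ^+ n = q 0 0 ^+ n -> p 0 1 ^+ n =
  q 0 1 ^+ n ->
  p 0 0 * p 0 1 = q 0 0 * q 0 1 -> chart_pt p w = chart_pt q w.
Proof. by rewrite /chart_pt => -> -> ->. Qed.

(** The inverse of the isomorphism. The choice of a representative (s, t) is
   harmless, as [chart_pt] depends on s^n, t^n and s t only. *)
Definition orbit_cell (Ow : orbits orb * W) : hess_variety K h :=
  cell_pt (orbit_rep Ow.1) Ow.2.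

Lemma orbit_cell_inj : injective orbit_cell.
Proof.
move=> [O w] [O' w'] /(congr1 sval) /flag_unip_inj e.
have {}e i j : xval (chart_pt (orbit_rep O) w) i j = xval (chart_pt (orbit_rep
  O') w') i j.
  exact: meval_eq.
have eO : O = O'.
  rewrite -(orbit_repK O) -(orbit_repK O'); apply: orbit_of_eq.
  - by rewrite -(chart_pt_X _ w) -(chart_pt_X _ w') !e.
  - rewrite -(chart_pt_Y _ w) -(chart_pt_Y _ w') e.
    by apply: eq_col2_sum => k _; exact: e.
  - by rewrite -(chart_pt_Z _ w) -(chart_pt_Z _ w') e.
congr pair => //; apply/rowP => k.
rewrite -(mevalXU (w 0) k) -(mevalXU (w' 0) k).
have [i [j [ij i_n _ ->]]] := xvarP K k.
rewrite -[LHS]/(free_val w i j) -[RHS]/(free_val w' i j).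
by rewrite -(chart_pt_free (orbit_rep O) w ij) // e chart_pt_free.
Qed.

(** Every point of X Y = Z^n has the form (s^n, t^n, s t): take an n-th root s of
   X and t = Z / s, or s = 0 and an n-th root t of Y when X = 0. *)
Lemma cell_pt_surj v : hess_cell h (flag_of (unip v)) ->
  exists p w, v =1 chart_pt p w.
Proof.
move=> /hess_cellP rel.
set x := xval v in rel; set Z := x 2%N 1%N; set X := Z ^+ 2 - x 3%N 1%N.
set Y := col2_sum x Z n.+1.
have XY : X * Y = Z ^+ n := hess_rel_kleinian hn rel.
have [s [t [sX tY stZ]]] : exists s t : K, [/\ s ^+ n = X, t ^+ n = Y & s * t
  = Z].
  have nth_root (c : K) : exists r, r ^+ n = c.
    have := @solve_monicpoly K n (fun i => if i == 0%N then c else 0) n0.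
    case=> r rE; exists r; rewrite rE (bigD1 (Ordinal n0)) //= mulr1.
    by rewrite big1 ?addr0 // => i; rewrite -val_eqE /= => /negPf ->;
      rewrite mul0r.
  have [s sX] := nth_root X; have [X0|X0] := eqVneq X 0.
    have Z0 : Z = 0 by apply/eqP; rewrite -expn_eq0 -XY X0 mul0r.
    have [t tY] := nth_root Y; exists 0, t.
    by rewrite mul0r X0 Z0 expr0n gtn_eqF.
  have s0 : s != 0 by rewrite -expn_eq0 sX.
  exists s, (Z / s); rewrite expr_div_n -XY sX mulrC mulKf //.
  by rewrite mulrC divfK.
pose w : W := \row_k coords x k.
exists (\row_i vec2 s t i), w => k.
rewrite -(mevalXU v k) -(mevalXU (chart_pt _ _) k).
have [i [j [ji i_n j_n ->]]] := xvarP K k; rewrite meval_xvar //.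
rewrite !mxE /vec2 /= sX tY stZ -[LHS]/(x i j) (hess_rel_chart hn rel) //.
apply: eq_chart => // a b ab a_n b1 nin.
rewrite /free_val -[LHS](@meval_xvar K n (free_vars n) x) //.
- by apply: meval_eq => l; rewrite mxE.
- rewrite /free_vars nin andbT; case/andP: ab => b0 ->; rewrite andbT.
  by rewrite ltn_neqAle eq_sym b1.
- by case/andP: ab => _ /ltnW/leq_trans; apply.
Qed.

Lemma orbit_cell_surj V : exists Ow, orbit_cell Ow = V.
Proof.
case: V => V hV; have [v vV] := opp_cell_unip hV.2; subst V.
have [p [w vE]] := cell_pt_surj hV; exists (orbit_of orb p, w).
rewrite /orbit_cell /cell_pt; apply: eq_exist; congr (flag_of (unip _));
  apply/funext => k; rewrite vE.
have [e0 e1 e01] := orbit_rep_of p.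
by rewrite (eq_chart_pt w e0 e1 e01).
Qed.

Local Notation FR := {mpoly K[nvars n (free_vars n)]}.

(** The pullback of functions along [chart_pt], with values in a tensor product so
   that it is visibly a sum of products of functions on the two factors. *)
Definition product_pullback : {mpoly K[nvars n below_diag]} -> tensor
  (XYZ_ring K n) FR :=
  mpoly_mor (coords (chart n (tens_inl FR (XYZ_class n 'X_0)) (tens_inl FR
    (XYZ_class n 'X_1))
    (tens_inl FR (XYZ_class n 'X_2)) (fun i j => tens_inr (XYZ_ring K n) (xvar
      i j)))).
HB.instance Definition _ := GRing.LRMorphism.on product_pullback.

Lemma product_pullbackE (p : 'rV[K]_2) (w : W) q :
  q.@[chart_pt p w] =
  tens_mor (orbifold_ev (p 0 0, p 0 1)) (meval (w 0) : {lrmorphism FR -> K^o})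
    (product_pullback q).
Proof.
pose f : {lrmorphism {mpoly K[nvars n below_diag]} -> K^o} :=
  tens_mor (orbifold_ev (p 0 0, p 0 1)) (meval (w 0) : {lrmorphism FR -> K^o})
  \o product_pullback.
suff e : (meval (chart_pt p w) : {lrmorphism {mpoly K[nvars n below_diag]} ->
  K^o}) =1 f
  by exact: e.
apply: mpoly_xvar_ext => i j ij i_n j_n; rewrite /f /= meval_xvar //.
rewrite /product_pullback mpoly_mor_xvar //
  chart_morph /= /tens_inl !tens_morE /= !rmorph1 !mulr1.
rewrite orbifold_evX orbifold_evY orbifold_evZ /=.
congr chart; apply/funext => k; apply/funext => l.
by rewrite /tens_inr tens_morE rmorph1 mul1r.
Qed.

(** A polynomial in the matrix entries that restricts to the product function
   given by p in X, Y, Z and q in the free coordinates. *)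
Definition product_coords (p : {mpoly K[3]}) (q : FR) : {mpoly K[nvars n
  below_diag]} :=
  mpoly_mor (vec3 (xvar 2 1 ^+ 2 - xvar 3 1) (col2_sum (fun i j => xvar i j)
    (xvar 2 1) n.+1)
     (xvar 2 1)) p * mpoly_mor (coords (fun i j => xvar i j)) q.

Lemma product_coordsE (p : 'rV[K]_2) (w : W) r q :
  (product_coords r q).@[chart_pt p w] =
  orbifold_ev (p 0 0, p 0 1) (XYZ_class n r) * q.@[w 0].
Proof.
rewrite /product_coords mevalM; congr (_ * _).
  rewrite orbifold_evE; set c := vec3 _ _ _.
  pose f : {lrmorphism {mpoly K[3]} -> K^o} := meval (chart_pt p w) \o
    mpoly_mor c.
  set d := vec3 _ _ _; suff e : f =1 mpoly_mor d by exact: e.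
  apply: mpoly_lrmorph_ext => i; rewrite /f /= !mpoly_morX /c /d.
  case: i => -[|[|[|//]]] i3; rewrite /vec3 /=.
  - by rewrite -(chart_pt_X p w) rmorphB rmorphXn.
  - by rewrite -(chart_pt_Y p w) col2_sum_morph.
  - by rewrite -(chart_pt_Z p w).
set c := coords _.
pose f : {lrmorphism FR -> K^o} := meval (chart_pt p w) \o mpoly_mor c.
suff e : f =1 (meval (w 0) : {lrmorphism FR -> K^o}) by exact: e.
apply: mpoly_xvar_ext => i j ij i_n j_n; rewrite /f /= /c mpoly_mor_xvar //.
exact: (chart_pt_free p w ij i_n).
Qed.

(** A regular function on the product pulls back to a regular one by
   [cyclic_invariant] and [product_coordsE]; conversely [product_pullbackE] splits
   a regular function on the cell into products. *)
Lemma hess_orbifold_iso :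
  var_iso (hess_variety K h)
    (var_prod (cyclic_quotient zeta) (affine_space K (nvars n (free_vars n)))).
Proof.
have [phi phiK] : exists phi, cancel phi orbit_cell.
  by have [phi phiE] := choice orbit_cell_surj; exists phi => V; exact: phiE.
have orbit_cellK : cancel orbit_cell phi.
  by move=> Ow; apply: orbit_cell_inj; rewrite phiK.
exists phi; split; first by exists orbit_cell.
move=> f; split=> [[r [g [k [g_reg k_reg fE]]]]|[q qE]].
  have /choice[a aE] i : exists a : XYZ_ring K n, forall p : 'rV[K]_2,
      g i (orbit_of orb p) = orbifold_ev (p 0 0, p 0 1) a.
    have [b bE] := g_reg i.
    have bE2 s t : b.@[vec2 s t] = g i (orbit_of orb (\row_l vec2 s t l)).
      by rewrite bE; apply: meval_eq => l; rewrite mxE.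
    have [s t|a aE] := @cyclic_invariant K n n0 zeta b prim.
      rewrite !bE2; congr (g i); apply: orbit_of_eq; rewrite !mxE /vec2 /=.
      - by rewrite exprMn (prim_expr_order prim) mul1r.
      - by rewrite exprMn exprVn (prim_expr_order prim) invr1 mul1r.
      - by rewrite mulrACA divff ?mul1r // (prim_neq0 n0 prim).
    exists a => p; rewrite -aE bE2; congr (g i); apply: orbit_of_eq;
      by rewrite !mxE.
  have /choice[b bE] := k_reg.
  exists (\sum_(i < r) product_coords (repr (a i)) (b i)) => v hv.
  have [[O w] OwE] := orbit_cell_surj (exist _ _ hv).
  rewrite /= -{1}OwE orbit_cellK fE raddf_sum /=; apply: eq_bigr => i _.
  have /funext -> : v =1 chart_pt (orbit_rep O) w.
    by apply: flag_unip_inj; have /(congr1 sval) := OwE => /= <-.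
  rewrite product_coordsE -[O in g i O]orbit_repK aE bE.
  by rewrite /XYZ_class reprK.
have fE O w : f (O, w) = tens_mor (orbifold_ev (orbit_rep O 0 0, orbit_rep O 0
  1))
    (meval (w 0) : {lrmorphism FR -> K^o}) (product_pullback q).
  rewrite -product_pullbackE -(qE _ (chart_pt_cell (orbit_rep O) w)) /=.
  by rewrite -[in LHS](orbit_cellK (O, w)).
set s := repr (product_pullback q).
exists (size s), (fun i (O : orbits orb) => orbifold_ev (orbit_rep O 0 0,
  orbit_rep O 0 1) (nth 0 s i).1),
  (fun i (w : W) => ((nth 0 s i).2).@[w 0]); split.
- move=> i; exists (orbifold_pullback n (repr (nth 0 s i).1)) => p.
  by rewrite orbifold_pullbackE /XYZ_class reprK; exact: orbifold_ev_rep.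
- by move=> i; exists (nth 0 s i).2.
- move=> O w; rewrite fE -[product_pullback q]reprK tens_mor_pi -/s.
  by rewrite (big_nth 0) big_mkord.
Qed.

End OrbifoldProduct.

(** * The cell is a Kleinian singularity times an affine space *)

Theorem theorem9p7 (R : realType) (n : nat) (hn : (3 <= n)%N) :
  let C : closedFieldType := R[i] in
  let x : nat -> nat -> hess_ring C (h2 hn) := hess_x C (h2 hn) in
  (exists phi :
     {lrmorphism
        tensor (tensor (XYZ_ring C n) {mpoly C[nvars n (col2_vars n)]})
               {mpoly C[nvars n right_vars]}
        -> hess_ring C (h2 hn)},
     [/\ bijective phi,
         [/\ phi (tens (tens (XYZ_class n 'X_0) 1) 1) = x 2%N 1%N ^+ 2 - x 3%N 1%N,
             phi (tens (tens (XYZ_class n 'X_1) 1) 1) =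
               x 2%N 1%N ^+ (n - 2) +
               \sum_(3 <= i < n.+1) x i 2%N * x 2%N 1%N ^+ (n - i) &
             phi (tens (tens (XYZ_class n 'X_2) 1) 1) = x 2%N 1%N],
         (forall i : nat, (3 <= i <= n - 1)%N ->
            phi (tens (tens 1 (xvar i 2)) 1) = x i 2%N) &
         (forall i j : nat, (3 <= j < i)%N -> (i <= n)%N ->
            phi (tens 1 (xvar i j)) = x i j)]) /\
  (forall zeta : C, n.-primitive_root zeta ->
     var_iso (hess_variety C (h2 hn))
       (var_prod (cyclic_quotient zeta)
          (affine_space C (((n - 1) * (n - 2)) %/ 2 - 1)%N))).
Proof.
move=> C x; split; last first.
  by move=> zeta prim; rewrite -card_free_vars //; exact: hess_orbifold_iso.
exists (@hess_phi C n hn); split.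
- exact: hess_phi_bij.
- split; rewrite /= hess_phi_XYZ.
  + exact: phi_X.
  + rewrite phi_Y /col2_sum [LHS]big_ltn ?ltnS ?(ltnW hn) //= mul1r.
    congr (_ + _); apply: eq_big_nat => i /andP[i3 _].
    by rewrite /col2 gtn_eqF.
  + exact: phi_Z.
- exact: hess_phi_col2.
- exact: hess_phi_right.
Qed.
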